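(* Let $d>1$ and $n\ge2$. The set $\Lambda=\Lambda_1\Lambda_2\cdots\Lambda_n$ is an $R_0$-basis of the Hecke algebra $H(d,1,n)$.
   Context: Let $R_0=\mathbb{Z}[a,b_1,b_2,\dots,b_{d-1}]$ (polynomial ring). $H(d,1,n)$ is the unitary associative $R_0$-algebra generated by $z,s_2,s_3,\dots,s_n$ with relations: (1) $zs_2zs_2=s_2zs_2z$; (2) $zs_j=s_jz$ for $3\le j\le n$; (3) $s_is_{i+1}s_i=s_{i+1}s_is_{i+1}$ for $2\le i\le n-1$; (4) $s_is_j=s_js_i$ for $|i-j|>1$; (5) $z^d-b_1z^{d-1}-b_2z^{d-2}-\cdots-b_{d-1}z-1=0$ and $s_j^2-as_j-1=0$ for $2\le j\le n$. Define the subsets of $H(d,1,n)$: $\Lambda_1=\{z^k: 0\le k\le d-1\}$ and for $2\le i\le n$, $\Lambda_i=\{1\}\cup\{s_i\cdots s_{i'}: 2\le i'\le i\}\cup\{s_i\cdots s_2z^k: 1\le k\le d-1\}\cup\{s_i\cdots s_2z^ks_2\cdots s_{i'}: 1\le k\le d-1,\ 2\le i'\le i\}$, where $s_i\cdots s_{i'}$ and $s_i\cdots s_2$ have decreasing consecutive indices and $s_2\cdots s_{i'}$ has increasing consecutive indices. $\Lambda=\Lambda_1\cdots\Lambda_n$ is the set (family) of products $a_1a_2\cdots a_n$ with $a_i\in\Lambda_i$ for $1\le i\le n$. *)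

(* Defs.v *)
From HB Require Import structures.
From mathcomp Require Import all_boot all_algebra.
From mathcomp Require Import boolp.
From mathcomp Require Import -(notations) monalg.
From mathcomp Require Import mpoly.

Set Implicit Arguments.
Unset Strict Implicit.
Unset Printing Implicit Defensive.

Import GRing.Theory.
Local Open Scope ring_scope.
Local Open Scope quotient_scope.

(* The free unitary associative R-algebra on the generators G: finitely
   supported functions from words over G to R, with the convolution product. *)
Definition freealg (R : comNzRingType) (G : choiceType) : Type :=
  malg (fmonom G) R.

HB.instance Definition _ (R : comNzRingType) (G : choiceType) :=
  GRing.Lalgebra.on (freealg R G).

Lemma freealg_scalerAr (R : comNzRingType) (G : choiceType) (c : R)
  (x y : freealg R G) : c *: (x * y) = x * (c *: y).
Proof.
suff cmC (u : freealg R G) : u * (c *: 1) = c *: u.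
  by rewrite -cmC -mulrA cmC.
have -> : c *: (1 : freealg R G) = mkmalgU (@one (fmonom G)) c.
  by rewrite -[LHS]mulr1 -[X in X * _](mul_malgC c) mulr1 mulr1.
rewrite -mul_malgC !malgM_def (fgmulEl1 u) (fgmulEr1 _ u).
apply: eq_bigr => k _; rewrite !fgmulUU mulrC.
by rewrite [mmul k _]mulm1 [mmul _ k]mul1m.
Qed.

HB.instance Definition _ (R : comNzRingType) (G : choiceType) :=
  GRing.LSemiAlgebra_isSemiAlgebra.Build R (freealg R G)
    (@freealg_scalerAr R G).

Definition freegen (R : comNzRingType) (G : choiceType) (g : G) :
  freealg R G := mkmalgU (fmu g) 1.

Definition two_sided_ideal (A : pzRingType) (I : A -> Prop) : Prop :=
  [/\ I 0,
      (forall x y, I x -> I y -> I (x - y)),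
      (forall u x, I x -> I (u * x)) &
      (forall x v, I x -> I (x * v))].

Definition ideal_gen (A : pzRingType) (rel : A -> Prop) (x : A) : Prop :=
  forall I : A -> Prop,
    two_sided_ideal I -> (forall r, rel r -> I r) -> I x.

Lemma ideal_genP (A : pzRingType) (rel : A -> Prop) :
  two_sided_ideal (ideal_gen rel).
Proof.
split=> [I [I0 _ _ _] _ //|x y Ix Iy I HI Hr|u x Ix I HI Hr|x v Ix I HI Hr].
- by case: (HI) => _ IB _ _; apply: IB; [exact: Ix | exact: Iy].
- by case: (HI) => _ _ IM _; apply: IM; exact: Ix.
- by case: (HI) => _ _ _ IM; apply: IM; exact: Ix.
Qed.

Section QuotientAlgebra.
Context (R : comNzRingType) (A : algType R) (rel : A -> Prop).
Local Notation I := (ideal_gen rel).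

Let I0 : I 0. Proof. by case: (ideal_genP rel). Qed.
Let IB x y : I x -> I y -> I (x - y).
Proof. by case: (ideal_genP rel) => _ + _ _; exact. Qed.
Let IMl u x : I x -> I (u * x).
Proof. by case: (ideal_genP rel) => _ _ + _; exact. Qed.
Let IMr x v : I x -> I (x * v).
Proof. by case: (ideal_genP rel) => _ _ _ +; exact. Qed.
Let IN x : I x -> I (- x).
Proof. by move=> Ix; rewrite -sub0r; exact: IB. Qed.
Let ID x y : I x -> I y -> I (x + y).
Proof. by move=> Ix Iy; rewrite -[y]opprK; apply: IB => //; exact: IN. Qed.
Let IZ c x : I x -> I (c *: x).
Proof. by move=> Ix; rewrite -[x]mul1r scalerAl; exact: IMl. Qed.

Definition ideal_equiv (x y : A) : bool := `[< I (x - y) >].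

Lemma ideal_equiv_refl : reflexive ideal_equiv.
Proof. by move=> x; apply/asboolP; rewrite subrr. Qed.

Lemma ideal_equiv_sym : ssrbool.symmetric ideal_equiv.
Proof.
by move=> x y; apply: asbool_equiv_eq; split=> /IN; rewrite opprB.
Qed.

Lemma ideal_equiv_trans : transitive ideal_equiv.
Proof.
move=> y x z /asboolP xy /asboolP yz; apply/asboolP.
by rewrite -(subrK y x) -addrA; exact: ID.
Qed.

Canonical ideal_equiv_rel :=
  EquivRel ideal_equiv ideal_equiv_refl ideal_equiv_sym ideal_equiv_trans.

(* A / I, where I is the two-sided ideal generated by rel *)
Definition quot_alg : Type := {eq_quot ideal_equiv}.

HB.instance Definition _ := Choice.on quot_alg.
HB.instance Definition _ := EqQuotient.on quot_alg.

Let piP x y : reflect (\pi_quot_alg x = \pi_quot_alg y) `[< I (x - y) >].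
Proof.
by apply: (iffP idP) => [|/eqP]; rewrite ?piE // => h; apply/eqP;
  rewrite piE.
Qed.

Let piE' x y : \pi_quot_alg x = \pi_quot_alg y <-> I (x - y).
Proof. by split=> [/piP/asboolP|h]; [|apply/piP/asboolP]. Qed.

Let reprP x : I (x - repr (\pi_quot_alg x)).
Proof. by apply/piE'; rewrite reprK. Qed.

Let piS q : exists x, q = \pi_quot_alg x.
Proof. by exists (repr q); rewrite reprK. Qed.

Definition quot_add (x y : quot_alg) : quot_alg :=
  \pi_quot_alg (repr x + repr y).
Definition quot_opp (x : quot_alg) : quot_alg := \pi_quot_alg (- repr x).
Definition quot_mul (x y : quot_alg) : quot_alg :=
  \pi_quot_alg (repr x * repr y).
Definition quot_scale (c : R) (x : quot_alg) : quot_alg :=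
  \pi_quot_alg (c *: repr x).

Let pi_add x y :
  quot_add (\pi_quot_alg x) (\pi_quot_alg y) = \pi_quot_alg (x + y).
Proof.
apply/esym/piE'; rewrite opprD addrACA; exact: ID.
Qed.

Let pi_opp x : quot_opp (\pi_quot_alg x) = \pi_quot_alg (- x).
Proof. by apply/esym/piE'; rewrite -opprD; exact: IN. Qed.

Let pi_mul x y :
  quot_mul (\pi_quot_alg x) (\pi_quot_alg y) = \pi_quot_alg (x * y).
Proof.
apply/esym/piE'; rewrite -(subrK (x * repr (\pi_quot_alg y)) (x * y)).
rewrite -mulrBr -addrA -mulrBl; apply: ID; [exact: IMl | exact: IMr].
Qed.

Let pi_scale c x : quot_scale c (\pi_quot_alg x) = \pi_quot_alg (c *: x).
Proof. by apply/esym/piE'; rewrite -scalerBr; exact: IZ. Qed.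

Let quot_addA : associative quot_add.
Proof.
by move=> x y t; case: (piS x) => {}x ->; case: (piS y) => {}y ->;
  case: (piS t) => {}t ->; rewrite !pi_add addrA.
Qed.
Let quot_addC : commutative quot_add.
Proof.
by move=> x y; case: (piS x) => {}x ->; case: (piS y) => {}y ->;
  rewrite !pi_add addrC.
Qed.
Let quot_add0 : left_id (\pi_quot_alg 0) quot_add.
Proof. by move=> x; case: (piS x) => {}x ->; rewrite pi_add add0r. Qed.
Let quot_addN : left_inverse (\pi_quot_alg 0) quot_opp quot_add.
Proof. by move=> x; case: (piS x) => {}x ->; rewrite pi_opp pi_add addNr. Qed.

HB.instance Definition _ := GRing.isZmodule.Build quot_alg
  quot_addA quot_addC quot_add0 quot_addN.

Let quot_mulA : associative quot_mul.
Proof.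
by move=> x y t; case: (piS x) => {}x ->; case: (piS y) => {}y ->;
  case: (piS t) => {}t ->; rewrite !pi_mul mulrA.
Qed.
Let quot_mul1l : left_id (\pi_quot_alg 1) quot_mul.
Proof. by move=> x; case: (piS x) => {}x ->; rewrite pi_mul mul1r. Qed.
Let quot_mul1r : right_id (\pi_quot_alg 1) quot_mul.
Proof. by move=> x; case: (piS x) => {}x ->; rewrite pi_mul mulr1. Qed.
Let quot_mulDl : left_distributive quot_mul quot_add.
Proof.
by move=> x y t; case: (piS x) => {}x ->; case: (piS y) => {}y ->;
  case: (piS t) => {}t ->; rewrite !(pi_mul, pi_add) mulrDl.
Qed.
Let quot_mulDr : right_distributive quot_mul quot_add.
Proof.
by move=> x y t; case: (piS x) => {}x ->; case: (piS y) => {}y ->;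
  case: (piS t) => {}t ->; rewrite !(pi_mul, pi_add) mulrDr.
Qed.

HB.instance Definition _ := GRing.Zmodule_isPzRing.Build quot_alg
  quot_mulA quot_mul1l quot_mul1r quot_mulDl quot_mulDr.

Let quot_scaleA a b v :
  quot_scale a (quot_scale b v) = quot_scale (a * b) v.
Proof. by case: (piS v) => {}v ->; rewrite !pi_scale scalerA. Qed.
Let quot_scale1 : left_id 1 quot_scale.
Proof. by move=> v; case: (piS v) => {}v ->; rewrite pi_scale scale1r. Qed.
Let quot_scaleDr : right_distributive quot_scale +%R.
Proof.
move=> c x y; case: (piS x) => {}x ->; case: (piS y) => {}y ->.
rewrite [LHS](congr1 (quot_scale c) (pi_add _ _)).
by rewrite !pi_scale scalerDr -pi_add.
Qed.
Let quot_scaleDl v : {morph quot_scale^~ v : a b / a + b}.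
Proof.
by move=> a b; case: (piS v) => {}v ->; rewrite !pi_scale scalerDl -pi_add.
Qed.

HB.instance Definition _ := GRing.Zmodule_isLmodule.Build R quot_alg
  quot_scaleA quot_scale1 quot_scaleDr quot_scaleDl.

Definition quot_proj (x : A) : quot_alg := \pi_quot_alg x.

Lemma quot_proj_eq x y : quot_proj x = quot_proj y <-> I (x - y).
Proof. exact: piE'. Qed.

Lemma quot_proj_surj (q : quot_alg) : exists x, q = quot_proj x.
Proof. by exists (repr q); rewrite /quot_proj reprK. Qed.

Lemma quot_proj_is_linear : linear quot_proj.
Proof. by move=> c x y; rewrite /quot_proj -pi_add -pi_scale. Qed.
HB.instance Definition _ := GRing.isLinear.Build R A quot_alg _ quot_proj
  quot_proj_is_linear.

Lemma quot_proj_is_monoid_morphism : monoid_morphism quot_proj.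
Proof. by split=> // x y; rewrite /quot_proj -pi_mul. Qed.
HB.instance Definition _ := GRing.isMonoidMorphism.Build A quot_alg quot_proj
  quot_proj_is_monoid_morphism.

Lemma quot_scalerAl (c : R) (u v : quot_alg) : c *: (u * v) = (c *: u) * v.
Proof.
case: (quot_proj_surj u) (quot_proj_surj v) => x -> [y ->].
by rewrite -rmorphM -!linearZ -rmorphM scalerAl.
Qed.

Lemma quot_scalerAr (c : R) (u v : quot_alg) : c *: (u * v) = u * (c *: v).
Proof.
case: (quot_proj_surj u) (quot_proj_surj v) => x -> [y ->].
by rewrite -rmorphM -!linearZ -rmorphM scalerAr.
Qed.

End QuotientAlgebra.

(* R_0 = Z[a, b_1, ..., b_{d-1}]: variable number 0 is a and variable number i
   is b_i (recall d.-1.+1 = d for d > 0) *)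
Notation R0 d := {mpoly int[d.-1.+1]}.

(* n generators: number 0 stands for z and number j.-1 for s_j (2 <= j <= n) *)
Notation hecke_gen n := 'I_n.-1.+1.

Section Hecke.
Context (d n : nat).

Definition par_a : R0 d := 'X_ord0.
Definition par_b (i : nat) : R0 d := 'X_(inord i).

Definition free_z : freealg (R0 d) (hecke_gen n) := freegen _ ord0.
Definition free_s (j : nat) : freealg (R0 d) (hecke_gen n) :=
  freegen _ (inord j.-1).

Local Notation z := free_z.
Local Notation s := free_s.

Inductive hecke_rel : freealg (R0 d) (hecke_gen n) -> Prop :=
| HeckeZSZS :
    hecke_rel (z * s 2 * z * s 2 - s 2 * z * s 2 * z)
| HeckeZS (j : nat) : (3 <= j <= n)%N ->
    hecke_rel (z * s j - s j * z)
| HeckeBraid (i : nat) : (2 <= i <= n.-1)%N ->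
    hecke_rel (s i * s i.+1 * s i - s i.+1 * s i * s i.+1)
| HeckeComm (i j : nat) :
    (2 <= i <= n)%N -> (2 <= j <= n)%N -> (i.+1 < j)%N || (j.+1 < i)%N ->
    hecke_rel (s i * s j - s j * s i)
| HeckeZ :
    hecke_rel (z ^+ d - \sum_(1 <= i < d) par_b i *: z ^+ (d - i) - 1)
| HeckeS (j : nat) : (2 <= j <= n)%N ->
    hecke_rel (s j ^+ 2 - par_a *: s j - 1).

Definition hecke : Type := quot_alg hecke_rel.

HB.instance Definition _ := GRing.PzRing.on hecke.
HB.instance Definition _ := GRing.Lmodule.on hecke.

(* hecke is nontrivial: the relations hold in int for the character
   a, b_i |-> 0 and z, s_j |-> 1 *)
Let ev : {rmorphism R0 d -> int} := meval (fun=> 0).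
Let one_word (m : fmonom (hecke_gen n)) : int := 1.
Let one_word_mmorphism : mmorphism one_word.
Proof. by split=> // x y; rewrite mulr1. Qed.
HB.instance Definition _ := isMultiplicative.Build (fmonom (hecke_gen n)) int
  one_word one_word_mmorphism.
Let chi (x : freealg (R0 d) (hecke_gen n)) : int :=
  monalg.mmap ev one_word x.

Let chiM x y : chi (x * y) = chi x * chi y.
Proof.
exact: (monalg.mmap_is_multiplicative (f := ev) (h := one_word)).1.
Qed.
Let chi1 : chi 1 = 1.
Proof.
exact: (monalg.mmap_is_multiplicative (f := ev) (h := one_word)).2.
Qed.
Let chiB x y : chi (x - y) = chi x - chi y.
Proof. exact: monalg.mmapB. Qed.
Let chiZ c x : chi (c *: x) = ev c * chi x.
Proof. exact: (monalg.mmapZ (f := ev) (h := one_word)). Qed.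
Let chi0 : chi 0 = 0.
Proof. exact: monalg.mmap0. Qed.
Let chiX x k : chi (x ^+ k) = chi x ^+ k.
Proof. by elim: k => [|k IHk]; rewrite ?chi1 // !exprS chiM IHk. Qed.
Let chi_gen g : chi (freegen _ g) = 1.
Proof. by rewrite /chi /freegen monalg.mmapU mulr1; exact: rmorph1. Qed.

Let chi_rel r : hecke_rel r -> chi r = 0.
Proof.
have cz : chi z = 1 by exact: chi_gen.
have cs j : chi (s j) = 1 by exact: chi_gen.
have cM x y : chi x = 1 -> chi y = 1 -> chi (x * y) = 1.
  by move=> cx cy; rewrite chiM cx cy.
have cB x y : chi x = 1 -> chi y = 1 -> chi (x - y) = 0.
  by move=> cx cy; rewrite chiB cx cy subrr.
have cB0 x y : chi x = 1 -> chi y = 0 -> chi (x - y) = 1.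
  by move=> cx cy; rewrite chiB cx cy subr0.
have cD x y : chi x = 0 -> chi y = 0 -> chi (x + y) = 0.
  by move=> cx cy; rewrite -[y]opprK -(sub0r y) !chiB chi0 cx cy.
have cX x k : chi x = 1 -> chi (x ^+ k) = 1.
  by move=> cx; rewrite chiX cx expr1n.
have cZ c x : ev c = 0 -> chi (c *: x) = 0 by move=> c0; rewrite chiZ c0 mul0r.
have va : ev par_a = 0 by exact: mevalXU.
have vb i : ev (par_b i) = 0 by exact: mevalXU.
case=> [|j _|i _|i j _ _ _||j _].
- exact: cB (cM _ _ (cM _ _ (cM _ _ cz (cs _)) cz) (cs _))
            (cM _ _ (cM _ _ (cM _ _ (cs _) cz) (cs _)) cz).
- exact: cB (cM _ _ cz (cs _)) (cM _ _ (cs _) cz).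
- exact: cB (cM _ _ (cM _ _ (cs _) (cs _)) (cs _))
            (cM _ _ (cM _ _ (cs _) (cs _)) (cs _)).
- exact: cB (cM _ _ (cs _) (cs _)) (cM _ _ (cs _) (cs _)).
- apply: cB chi1; apply: cB0 (cX _ _ cz) _.
  elim/big_rec: _ => [|i x _ cx]; first exact: chi0.
  exact: cD (cZ _ _ (vb i)) cx.
- exact: cB (cB0 _ _ (cX _ _ (cs _)) (cZ _ _ va)) chi1.
Qed.

Lemma hecke_oner_neq0 : (1 : hecke) != 0.
Proof.
apply/eqP => h; have /quot_proj_eq : quot_proj hecke_rel 1 = quot_proj _ 0.
  by rewrite rmorph1 rmorph0.
rewrite subr0 => /(_ (fun x => chi x = 0)) H.
have /eqP : chi 1 = 0.
  apply: H chi_rel; split=> [|x y|u x|x v]; rewrite ?chiM ?chiB //.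
  - by move=> -> ->; rewrite subrr.
  - by move=> ->; rewrite mulr0.
  - by move=> ->; rewrite mul0r.
by rewrite chi1.
Qed.

HB.instance Definition _ :=
  GRing.PzSemiRing_isNonZero.Build hecke hecke_oner_neq0.
HB.instance Definition _ :=
  GRing.LSemiModule_isLSemiAlgebra.Build (R0 d) hecke
    (@quot_scalerAl _ _ hecke_rel).
HB.instance Definition _ :=
  GRing.LSemiAlgebra_isSemiAlgebra.Build (R0 d) hecke
    (@quot_scalerAr _ _ hecke_rel).

Definition hecke_z : hecke := quot_proj hecke_rel free_z.
Definition hecke_s (j : nat) : hecke := quot_proj hecke_rel (free_s j).

(* s_i s_{i-1} ... s_j and s_2 s_3 ... s_j *)
Definition s_down (i j : nat) : hecke :=
  \prod_(k <- rev (index_iota j i.+1)) hecke_s k.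
Definition s_up (j : nat) : hecke := \prod_(2 <= k < j.+1) hecke_s k.

Definition Lambda_ (i : nat) : seq hecke :=
  if i == 1%N then [seq hecke_z ^+ k | k <- index_iota 0 d]
  else [:: 1]
    ++ [seq s_down i i' | i' <- index_iota 2 i.+1]
    ++ [seq s_down i 2 * hecke_z ^+ k | k <- index_iota 1 d]
    ++ [seq s_down i 2 * hecke_z ^+ k * s_up i'
         | k <- index_iota 1 d, i' <- index_iota 2 i.+1].

(* the family of products a_1 a_2 ... a_n, with one entry for each choice of an
   entry a_i in every Lambda_i *)
Definition Lambda : seq hecke :=
  foldr (fun i P => [seq x * y | x <- Lambda_ i, y <- P]) [:: 1]
    (index_iota 1 n.+1).

End Hecke.

(* The family of the entries of e is a basis of V; in particular, the entries
   are pairwise distinct when R is nontrivial. *)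
Definition is_basis (R : pzRingType) (V : lmodType R) (e : seq V) : Prop :=
  (forall v : V, exists c : 'I_(size e) -> R,
     v = \sum_(i < size e) c i *: e`_i)
  /\ (forall c : 'I_(size e) -> R,
       \sum_(i < size e) c i *: e`_i = 0 -> forall i, c i = 0).

(* Main.v *)
(* Spanning: let H_k be the subalgebra generated by z, s_2, ..., s_k. The span of
   H_{k-1} Lambda_k is stable under right multiplication by these generators; the
   only product that is not a plain rewriting of words is
   s_2 z^p s_2 z = z s_2 z^p s_2 + a (z^p s_2 z - z s_2 z^p).

   Independence: Lambda has d^n n! entries, and H acts on a free module of that
   rank, a weight space of the tensor representation of Ariki, Terasoma and
   Yamada. It has a basis of words of n distinct letters, each having one of d
   colors; s_i acts by an R-matrix T_i on letters i - 1 and i, and z acts by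
   T_2^-1 ... T_n^-1 S_n ... S_2 P, where S_i is T_i on letters of the same
   color and swaps letters of different colors, and P multiplies a word by the
   root u_c of the polynomial of z attached to the color c of its first letter.
   For a = 0 the action is by monomial matrices, and the sum of all colorings of
   a given word is a cyclic vector if the u_c are distinct. Since Lambda spans H,
   it follows that Lambda applied to this vector gives a square matrix with
   nonzero determinant at a = 0. Hence all coefficients of a linear relation
   vanish under every specialization that keeps a generic and makes the roots of
   the polynomial of z distinct, and a nonzero coefficient survives one of
   these. *)

Require Import Defs.
From HB Require Import structures.
From mathcomp Require Import all_boot all_fingroup all_algebra all_field.
From mathcomp Require Import boolp.
From mathcomp Require Import -(notations) monalg.
From mathcomp Require Import mpoly.
From mathcomp Require Import zify ring.

Set Implicit Arguments.
Unset Strict Implicit.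
Unset Printing Implicit Defensive.

Import GRing.Theory Num.Theory.
Local Open Scope ring_scope.

(** * The Ariki-Terasoma-Yamada module *)

Section ColoredWords.
Context (d n : nat).

(* The letter in position i of the word b is the pair (b.1 i, b.2 i), of which
   the first component is the color; the letters are distinct because their
   second components are. *)
Definition cword : Type := ({ffun 'I_n -> 'I_d} * 'S_n)%type.
HB.instance Definition _ := Finite.on cword.

Implicit Types (b : cword) (p q r i : 'I_n).

(** Permutes positions. It is a left action because the left factor of a product in ['S_n] is
    applied first. *)
Definition permw (s : 'S_n) b : cword := ([ffun i => b.1 (s i)], (s * b.2)%g).
Definition color b i : nat := b.1 i.
Definition rank b i : nat := (b.1 i * n + b.2 i)%N.

Lemma permwM s t b : permw s (permw t b) = permw (s * t) b.
Proof.
by rewrite /permw mulgA; congr (_, _); apply/ffunP => i; rewrite !ffunE permM.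
Qed.

Lemma permw1 b : permw 1 b = b.
Proof.
rewrite /permw mul1g; case: b => c w /=; congr (_, _).
by apply/ffunP => i; rewrite ffunE perm1.
Qed.

Lemma color_perm s b i : color (permw s b) i = color b (s i).
Proof. by rewrite /color ffunE. Qed.

Lemma rank_perm s b i : rank (permw s b) i = rank b (s i).
Proof. by rewrite /rank ffunE permM. Qed.

Lemma rank_neq b p q : p != q -> rank b p != rank b q.
Proof.
apply: contra; rewrite /rank => /eqP h.
have: (b.2 p = b.2 q :> nat).
  have := congr1 (modn^~ n) h.
  by rewrite /= !modnMDl !modn_small.
by move=> /val_inj/perm_inj ->.
Qed.

Lemma rank_color b p q : (color b p < color b q)%N -> (rank b p < rank b q)%N.
Proof.
rewrite /color /rank => h; have := ltn_ord (b.2 p); have := ltn_ord (b.2 q).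
by move: h; nia.
Qed.

(* Letters are compared lexicographically, color first, so that the letters of
   a given color are consecutive: this is the convexity expressed by the last
   three conjuncts. *)
Definition rank_pattern (g12 g23 g13 e12 e23 e13 : bool) : bool :=
  [&& (g12 == g23) ==> (g13 == g12),
      e12 && e23 ==> e13, e12 && e13 ==> e23, e13 && e23 ==> e12,
      (g12 == g23) && e13 ==> e12, (g13 != g23) && e12 ==> e13
    & (g12 != g13) && e23 ==> e12].

Lemma rank_patternP b p q r : p != q -> q != r -> p != r ->
  rank_pattern
    (rank b q < rank b p)%N (rank b r < rank b q)%N (rank b r < rank b p)%N
    (color b p == color b q) (color b q == color b r) (color b p == color b r).
Proof.
move=> /(rank_neq b) + /(rank_neq b) + /(rank_neq b).
move: (@rank_color b p q) (@rank_color b q p) (@rank_color b q r).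
move: (@rank_color b r q) (@rank_color b p r) (@rank_color b r p).
move: (rank b p) (rank b q) (rank b r) (color b p) (color b q) (color b r).
by rewrite /rank_pattern => {p q r b} k1 k2 k3 c1 c2 c3; lia.
Qed.

Lemma card_cword : #|{: cword}| = (d ^ n * n`!)%N.
Proof.
rewrite card_prod card_ffun !card_ord; congr (_ * _)%N.
exact: card_Sn.
Qed.

End ColoredWords.

(** * Operators on two positions of a word *)

Section Strands.
Context (d n : nat) (D : comNzRingType) (a : D).
Local Notation M := {ffun cword d n -> D^o}.
Implicit Types (b : cword d n) (p q r i : 'I_n) (f : M).

Definition inv_all b p q : bool := (rank b q < rank b p)%N.
Definition inv_same b p q : bool :=
  (color b p == color b q) && (rank b q < rank b p)%N.

(** A vector is given by its coordinates on the words. The R-matrix swaps the letters in positions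
    [p] and [q] and has the diagonal entry [a] at the words where [g] holds. *)
Definition strand (g : cword d n -> 'I_n -> 'I_n -> bool) p q f : M :=
  [ffun b => f (permw (tperm p q) b) + (a *+ g b p q) * f b].

Definition opT := strand inv_all.
Definition opS := strand inv_same.
(** The inverse of [opT]: from T^2 = a T + 1 follows T (T - a) = 1. *)
Definition opV p q f : M := opT p q f - a *: f.

Lemma tperm_braid p q r : p != q -> q != r -> p != r ->
  (tperm q r * tperm p q * tperm q r = tperm p q * tperm q r * tperm p q)%g.
Proof.
move=> pq qr pr.
have -> : (tperm q r * tperm p q * tperm q r = tperm p q ^ tperm q r)%g.
  by rewrite /conjg tpermV mulgA.
have -> : (tperm p q * tperm q r * tperm p q = tperm q r ^ tperm p q)%g.
  by rewrite /conjg tpermV mulgA.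
by rewrite !tpermJ !(tpermL, tpermR) !tpermD // eq_sym.
Qed.

Lemma tperm_fix p q r : p != q -> q != r -> p != r ->
  (tperm q r p = p) * (tperm p q r = r).
Proof. by move=> pq qr pr; rewrite !tpermD // eq_sym. Qed.

Lemma rank_ltnC b p q : p != q ->
  (rank b p < rank b q)%N = ~~ (rank b q < rank b p)%N.
Proof. by move=> /(rank_neq b); case: ltngtP. Qed.

(** At a word b, both sides are combinations of values of f at rearrangements of b. The comparisons
    of ranks and colors allowed by [rank_pattern] leave finitely many identities for [ring]. *)
Ltac strand_cases p q r pq qr pr :=
  let b := fresh "b" in
  apply/ffunP => b; rewrite /opT /opS !ffunE;
  rewrite /inv_all /inv_same !(color_perm, rank_perm, permM);
  rewrite !(tpermL, tpermR, tperm_fix pq qr pr);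
  rewrite !permwM ?mulgA ?(tperm_braid pq qr pr) -?mulgA;
  rewrite ?tperm2 ?mulg1 ?permw1;
  rewrite ?(rank_ltnC b pq) ?(rank_ltnC b qr) ?(rank_ltnC b pr);
  rewrite ?(eq_sym (color b q) (color b p)) ?(eq_sym (color b r));
  move: (rank_patternP b pq qr pr);
  do 3![case: (_ < _)%N]; do 3![case: (_ == _)] => //= _;
  rewrite ?(mulr0n, mulr1n) /=; ring.

(** This and [opS_S_T] carry T across two factors S with a shift of position; the relations of Z
    with the T_k rest on them. *)
Lemma opT_S_S p q r f : p != q -> q != r -> p != r ->
  opT p q (opS q r (opS p q f)) = opS q r (opS p q (opT q r f)).
Proof. by move=> pq qr pr; strand_cases p q r pq qr pr. Qed.

Lemma opS_S_T p q r f : p != q -> q != r -> p != r ->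
  opT q r (opS p q (opS q r f)) = opS p q (opS q r (opT p q f)).
Proof. by move=> pq qr pr; strand_cases p q r pq qr pr. Qed.

Lemma opT_braid p q r f : p != q -> q != r -> p != r ->
  opT p q (opT q r (opT p q f)) = opT q r (opT p q (opT q r f)).
Proof. by move=> pq qr pr; strand_cases p q r pq qr pr. Qed.

Lemma opS_braid p q r f : p != q -> q != r -> p != r ->
  opS p q (opS q r (opS p q f)) = opS q r (opS p q (opS q r f)).
Proof. by move=> pq qr pr; strand_cases p q r pq qr pr. Qed.

Ltac two_strand_cases p pq :=
  rewrite /inv_all /inv_same ?(color_perm, rank_perm, permM);
  rewrite ?(tpermL, tpermR) ?permwM ?tperm2 ?permw1 ?(rank_ltnC _ pq);
  rewrite ?(eq_sym (color _ _) (color _ p));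
  case: (_ < _)%N; try case: (_ == _) => //=;
  rewrite ?(mulr0n, mulr1n) /=.

Lemma opTT p q f : p != q -> opT p q (opT p q f) = a *: opT p q f + f.
Proof.
move=> pq; apply/ffunP => b; rewrite /opT !ffunE -[a *: _]/(a * _).
by two_strand_cases p pq; ring.
Qed.

Lemma opS_S_T2 p q f : p != q ->
  opS p q (opS p q (opT p q f)) = opT p q (opS p q (opS p q f)).
Proof.
move=> pq; apply/ffunP => b; rewrite /opT /opS !ffunE.
by two_strand_cases p pq; ring.
Qed.

Lemma opTK p q : p != q -> cancel (opT p q) (opV p q).
Proof. by move=> pq f; rewrite /opV opTT // [a *: _ + _]addrC addrK. Qed.

Lemma strand_is_linear g p q : linear (strand g p q).
Proof.
move=> c f1 f2; apply/ffunP => b; rewrite !ffunE.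
rewrite -![c *: _]/(c * _); ring.
Qed.

HB.instance Definition _ g p q :=
  GRing.isLinear.Build D M M _ (strand g p q) (strand_is_linear g p q).
HB.instance Definition _ p q := GRing.Linear.on (opT p q).
HB.instance Definition _ p q := GRing.Linear.on (opS p q).

Lemma opV_is_linear p q : linear (opV p q).
Proof.
move=> c f1 f2; rewrite /opV linearP scalerBr scalerDr !scalerA [a * c]mulrC.
by rewrite addrACA opprD.
Qed.

HB.instance Definition _ p q :=
  GRing.isLinear.Build D M M _ (opV p q) (opV_is_linear p q).

Lemma opVK p q : p != q -> cancel (opV p q) (opT p q).
Proof.
by move=> pq f; rewrite /opV linearB linearZ /= opTT // [a *: _ + _]addrC addrK.
Qed.

(** Ensures that permuting letters away from positions p and q does not change [g b p q], as needed
    for distant strands to commute. *)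
Definition equivariant (g : cword d n -> 'I_n -> 'I_n -> bool) : Prop :=
  forall s b p q, g (permw s b) p q = g b (s p) (s q).

Lemma inv_all_equi : equivariant inv_all.
Proof. by move=> s b p q; rewrite /inv_all !rank_perm. Qed.

Lemma inv_same_equi : equivariant inv_same.
Proof. by move=> s b p q; rewrite /inv_same !rank_perm !color_perm. Qed.

Lemma strandC g h p q r s f : equivariant g -> equivariant h ->
    [&& p != r, p != s, q != r & q != s] ->
  strand g p q (strand h r s f) = strand h r s (strand g p q f).
Proof.
move=> gE hE /and4P[pr ps qr qs]; apply/ffunP => b; rewrite !ffunE gE hE.
have E x y z : x != y -> x != z -> tperm y z x = x.
  by move=> xy xz; rewrite tpermD // eq_sym.
rewrite !E // 1?eq_sym // !permwM.
have -> : (tperm r s * tperm p q = tperm p q * tperm r s)%g.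
  have := tpermJ p q (tperm r s); rewrite !E // => /conjg_fixP/commgP/esym.
  by [].
ring.
Qed.

Variable u : nat -> D.

Definition opP p f : M := [ffun b => u (color b p) * f b].

Lemma opP_is_linear p : linear (opP p).
Proof.
move=> c f1 f2; apply/ffunP => b; rewrite !ffunE.
rewrite -![c *: _]/(c * _); ring.
Qed.

HB.instance Definition _ p :=
  GRing.isLinear.Build D M M _ (opP p) (opP_is_linear p).

Lemma opP_strand g p q r f : r != p -> r != q ->
  opP r (strand g p q f) = strand g p q (opP r f).
Proof.
move=> rp rq; apply/ffunP => b; rewrite !ffunE color_perm tpermD 1?eq_sym //.
ring.
Qed.

(** The diagonal term of S occurs only for two letters of the same color, on which [opP p] and
    [opP q] agree. *)
Lemma opP_S p q f : opP p (opS p q f) = opS p q (opP q f).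
Proof.
apply/ffunP => b; rewrite !ffunE color_perm tpermR /inv_same.
by case: eqP => [->|_] /=; rewrite ?mulr0n; ring.
Qed.

(** The product of the two factors is symmetric in the two letters, so it commutes with the swap and
    with the diagonal term. *)
Lemma opP_P_T p q f : opP q (opP p (opT p q f)) = opT p q (opP q (opP p f)).
Proof.
by apply/ffunP => b; rewrite !ffunE !color_perm tpermL tpermR; ring.
Qed.

End Strands.

(** * The operators T_k, S_k and Z, and their relations *)

Section ArikiTerasomaYamada.
Context (d m : nat) (D : comNzRingType) (a : D) (u : nat -> D).
Local Notation n := m.+1.
Local Notation M := {ffun cword d n -> D^o}.
Local Notation pos k := (inord k : 'I_n).
Implicit Types (f : M) (b : cword d n) (j k l p : nat).

Definition opTn k : M -> M := opT a (pos k) (pos k.+1).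
Definition opSn k : M -> M := opS a (pos k) (pos k.+1).
Definition opVn k : M -> M := opV a (pos k) (pos k.+1).
Definition opPn k : M -> M := opP u (pos k).

HB.instance Definition _ k := GRing.Linear.on (opTn k).
HB.instance Definition _ k := GRing.Linear.on (opSn k).
HB.instance Definition _ k := GRing.Linear.on (opVn k).
HB.instance Definition _ k := GRing.Linear.on (opPn k).

Lemma pos_eq i j : (i < n)%N -> (j < n)%N -> (pos i == pos j) = (i == j).
Proof. by move=> im jm; rewrite -val_eqE /= !inordK. Qed.

Lemma pos_neq k : (k < m)%N -> pos k != pos k.+1.
Proof. by move=> km; rewrite pos_eq; lia. Qed.

Lemma opTnK k : (k < m)%N -> cancel (opTn k) (opVn k).
Proof. by move=> km; apply: opTK; exact: pos_neq. Qed.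

Lemma opVnK k : (k < m)%N -> cancel (opVn k) (opTn k).
Proof. by move=> km; apply: opVK; exact: pos_neq. Qed.

Lemma opTn_quad k f : (k < m)%N -> opTn k (opTn k f) = a *: opTn k f + f.
Proof. by move=> km; apply: opTT; exact: pos_neq. Qed.

Definition disjoint_pos j k : bool :=
  [&& (j < m)%N, (k < m)%N & (k.+1 < j)%N || (j.+1 < k)%N].

Lemma disjoint_posP j k : disjoint_pos j k ->
  [&& pos j != pos k, pos j != pos k.+1, pos j.+1 != pos k
    & pos j.+1 != pos k.+1].
Proof. by case/and3P=> jm km jk; rewrite !pos_eq; lia. Qed.

Lemma opTn_opTn j k f : disjoint_pos j k ->
  opTn j (opTn k f) = opTn k (opTn j f).
Proof.
by move=> /disjoint_posP; apply: strandC => ? *; exact: inv_all_equi.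
Qed.

Lemma opTn_opSn j k f : disjoint_pos j k ->
  opTn j (opSn k f) = opSn k (opTn j f).
Proof.
move=> /disjoint_posP; apply: strandC => ? *;
  [exact: inv_all_equi | exact: inv_same_equi].
Qed.

Lemma opSn_opSn j k f : disjoint_pos j k ->
  opSn j (opSn k f) = opSn k (opSn j f).
Proof.
by move=> /disjoint_posP; apply: strandC => ? *; exact: inv_same_equi.
Qed.

Lemma pos_distinct k : (k.+1 < m)%N ->
  [/\ pos k != pos k.+1, pos k.+1 != pos k.+2 & pos k != pos k.+2].
Proof. by move=> km; split; rewrite pos_eq; lia. Qed.

Lemma opTn_braid k f : (k.+1 < m)%N ->
  opTn k (opTn k.+1 (opTn k f)) = opTn k.+1 (opTn k (opTn k.+1 f)).
Proof. by move=> /pos_distinct[]; exact: opT_braid. Qed.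

Lemma opSn_braid k f : (k.+1 < m)%N ->
  opSn k (opSn k.+1 (opSn k f)) = opSn k.+1 (opSn k (opSn k.+1 f)).
Proof. by move=> /pos_distinct[]; exact: opS_braid. Qed.

Lemma opTn_S_S k f : (k.+1 < m)%N ->
  opTn k (opSn k.+1 (opSn k f)) = opSn k.+1 (opSn k (opTn k.+1 f)).
Proof. by move=> /pos_distinct[]; exact: opT_S_S. Qed.

Lemma opSn_S_T k f : (k.+1 < m)%N ->
  opTn k.+1 (opSn k (opSn k.+1 f)) = opSn k (opSn k.+1 (opTn k f)).
Proof. by move=> /pos_distinct[]; exact: opS_S_T. Qed.

Lemma opSn_S_T2 k f : (k < m)%N ->
  opSn k (opSn k (opTn k f)) = opTn k (opSn k (opSn k f)).
Proof. by move=> km; apply: opS_S_T2; exact: pos_neq. Qed.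

(** An operator that intertwines T_j and T_k also intertwines their inverses. *)
Lemma opV_comm (X : M -> M) j k : (j < m)%N -> (k < m)%N ->
    (forall f, X (opTn j f) = opTn k (X f)) ->
  forall f, X (opVn j f) = opVn k (X f).
Proof.
by move=> jm km XT f; rewrite -[LHS](opTnK km) -XT opVnK.
Qed.

Lemma opTn_V_V k f : (k.+1 < m)%N ->
  opTn k (opVn k.+1 (opVn k f)) = opVn k.+1 (opVn k (opTn k.+1 f)).
Proof.
move=> km; have km' := ltnW km.
apply: (can_inj (opTnK km)); rewrite opVnK //.
apply: (can_inj (opTnK km')); rewrite opVnK //.
by rewrite opTn_braid // !opVnK.
Qed.

Lemma opVn_S_S k f : (k.+1 < m)%N ->
  opVn k (opSn k.+1 (opSn k f)) = opSn k.+1 (opSn k (opVn k.+1 f)).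
Proof.
move=> km; have km' := ltnW km.
symmetry; apply: (opV_comm (X := fun g => opSn k.+1 (opSn k g))) => // g.
by rewrite opTn_S_S.
Qed.

(* opY l p = T_p^-1 ... T_{p+l-1}^-1 S_{p+l-1} ... S_p. *)
Fixpoint opY l p f : M :=
  if l is l'.+1 then opVn p (opY l' p.+1 (opSn p f)) else f.

Lemma opY_is_linear l p : linear (opY l p).
Proof.
by elim: l p => [|l IHl] p c f1 f2 //=; rewrite linearP IHl linearP.
Qed.

HB.instance Definition _ l p :=
  GRing.isLinear.Build D M M _ (opY l p) (opY_is_linear l p).

Lemma opY_comm l p (X : M -> M) : (p + l <= m)%N ->
    (forall k f, (p <= k < p + l)%N -> X (opTn k f) = opTn k (X f)) ->
    (forall k f, (p <= k < p + l)%N -> X (opSn k f) = opSn k (X f)) ->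
  forall f, X (opY l p f) = opY l p (X f).
Proof.
elim: l p => [//|l IHl] p pl XT XS f /=.
rewrite (opV_comm (X := X) (k := p)) ?IHl ?XS //; try lia.
- by move=> k g pk; apply: XT; lia.
- by move=> k g pk; apply: XS; lia.
- by move=> g; apply: XT; lia.
Qed.

(** For k > p + 1, T_k commutes with the outer factors and induction applies. For k = p + 1, it
    crosses S_{p+1} S_p as T_p, commutes with the inner factor, which involves positions from p + 2
    on only, and becomes T_{p+1} again across T_p^-1 T_{p+1}^-1. *)
Lemma opTn_Y l p k f : (p + l = m)%N -> (p < k < m)%N ->
  opTn k (opY l p f) = opY l p (opTn k f).
Proof.
elim: l p f => [|l IHl] p f pl /andP[pk km]; first by lia.
have [kp|kp] := eqVneq k p.+1; last first.
  rewrite /= -opTn_opSn -?IHl; try by rewrite /disjoint_pos; lia.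
  apply: opV_comm; try lia.
  by move=> g; apply: opTn_opTn; rewrite /disjoint_pos; lia.
subst k; case: l pl {IHl} => [|l] pl; first by lia.
have pm : (p.+1 < m)%N by lia.
move=> /=; rewrite -(opTn_S_S _ pm).
rewrite -(opY_comm (X := opTn p)); last 3 first.
- lia.
- by move=> k g kb; apply: opTn_opTn; rewrite /disjoint_pos; lia.
- by move=> k g kb; apply: opTn_opSn; rewrite /disjoint_pos; lia.
have E g : opTn p.+1 (opVn p (opVn p.+1 g)) = opVn p (opVn p.+1 (opTn p g)).
  apply: (can_inj (opTnK (ltnW pm))); rewrite opVnK ?(ltnW pm) //.
  apply: (can_inj (opTnK pm)); rewrite opVnK //.
  by rewrite -opTn_braid // !opVnK ?(ltnW pm).
by rewrite E.
Qed.

(** Let Q_p be [opSn p] followed by the factor [opY] that starts at p + 1. The braid relations give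
    Q_p^2 = T_{p+1}^-1 T_p^-1 Q_{p+1}^2 S_p S_{p+1}; the outer factors exchange T_p with T_{p+1},
    and induction applies to Q_{p+1}. *)
Lemma opTn_YSYS l p f : (p + l.+1 = m)%N ->
  opTn p (opY l p.+1 (opSn p (opY l p.+1 (opSn p f)))) =
  opY l p.+1 (opSn p (opY l p.+1 (opSn p (opTn p f)))).
Proof.
elim: l p f => [|l IHl] p f pl /=; first by rewrite -opSn_S_T2 //; lia.
have pm : (p.+1 < m)%N by lia.
have pm' := ltnW pm.
have YS g : opSn p (opY l p.+2 g) = opY l p.+2 (opSn p g).
  apply: opY_comm; first lia.
  - by move=> k h kb; rewrite opTn_opSn // /disjoint_pos; lia.
  - by move=> k h kb; apply: opSn_opSn; rewrite /disjoint_pos; lia.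
have YV g : opVn p (opY l p.+2 g) = opY l p.+2 (opVn p g).
  apply: opY_comm; first lia.
  - move=> k h kb; symmetry; apply: opV_comm; try lia.
    by move=> h'; apply: opTn_opTn; rewrite /disjoint_pos; lia.
  - move=> k h kb; symmetry; apply: opV_comm; try lia.
    by move=> h'; symmetry; apply: opTn_opSn; rewrite /disjoint_pos; lia.
have E g : opVn p.+1 (opY l p.+2 (opSn p.+1 (opSn p (opVn p.+1 (opY l p.+2
     (opSn p.+1 (opSn p g))))))) =
  opVn p.+1 (opVn p (opY l p.+2 (opSn p.+1 (opY l p.+2 (opSn p.+1
     (opSn p (opSn p.+1 g))))))).
  by rewrite -opVn_S_S // -YV YS -opSn_braid.
rewrite !E -opSn_S_T // -IHl //; last by lia.
by rewrite opTn_V_V.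
Qed.

Definition opZ f : M := opY m 0 (opPn 0 f).

Lemma opZ_is_linear : linear opZ.
Proof. by move=> c f1 f2; rewrite /opZ !linearP. Qed.

HB.instance Definition _ :=
  GRing.isLinear.Build D M M _ opZ opZ_is_linear.

Lemma opZ_T k f : (0 < k < m)%N -> opZ (opTn k f) = opTn k (opZ f).
Proof.
move=> km; rewrite /opZ opTn_Y //; congr opY.
by apply: opP_strand; rewrite pos_eq; lia.
Qed.

(** T_0 cancels the leftmost factor of Z, so (T_0 Z)^2 = (Y S_0)^2 P_1 P_0 with Y = [opY l 1]. Both
    (Y S_0)^2 and P_1 P_0 commute with T_0. *)
Lemma opZ_reflection f : (0 < m)%N ->
  opZ (opTn 0 (opZ (opTn 0 f))) = opTn 0 (opZ (opTn 0 (opZ f))).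
Proof.
move=> m_gt0; pose l := m.-1; have lm : l.+1 = m by rewrite prednK.
have TZ g : opTn 0 (opZ g) = opY l 1 (opSn 0 (opPn 0 g)).
  rewrite /opZ; have -> : opY m 0 (opPn 0 g) = opY l.+1 0 (opPn 0 g).
    by rewrite lm.
  by rewrite /= opVnK.
have PY g : opPn 0 (opY l 1 g) = opY l 1 (opPn 0 g).
  apply: opY_comm; first lia.
  - by move=> k h kb; apply: opP_strand; rewrite pos_eq; lia.
  - by move=> k h kb; apply: opP_strand; rewrite pos_eq; lia.
have TZTZ g : opTn 0 (opZ (opTn 0 (opZ g))) =
    opY l 1 (opSn 0 (opY l 1 (opSn 0 (opPn 1 (opPn 0 g))))).
  by rewrite !TZ PY [opPn 0 (opSn 0 _)]opP_S.
apply: (can_inj (opTnK m_gt0)); rewrite !TZTZ opTn_YSYS ?lm //.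
by rewrite [opPn 1 _]opP_P_T.
Qed.

(* Makes Z triangular with respect to the color of the first letter. *)
Lemma opY_diag l p f b : (p + l = m)%N ->
    (forall b', (forall i : 'I_n, (i < p)%N -> color b' i = color b i) ->
       (color b (pos p) < color b' (pos p))%N -> f b' = 0) ->
  opY l p f b = f b.
Proof.
elim: l p f b => [//|l IHl] p f b pl f0 /=.
set F := opSn p f; pose s := @permw d n (tperm (pos p) (pos p.+1)).
have pm : (p < m)%N by lia.
have pq := pos_neq pm.
have tlow (i : 'I_n) : (i < p)%N -> tperm (pos p) (pos p.+1) i = i.
  by move=> ip; rewrite tpermD // -val_eqE /= inordK; lia.
have colP b' : color (s b') (pos p) = color b' (pos p.+1).
  by rewrite color_perm tpermL.
have colQ b' : color (s b') (pos p.+1) = color b' (pos p).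
  by rewrite color_perm tpermR.
have colL b' (i : 'I_n) : (i < p)%N -> color (s b') i = color b' i.
  by move=> ip; rewrite color_perm tlow.
have ss b' : s (s b') = b' by rewrite /s permwM tperm2 permw1.
have FE b' : F b' = f (s b') + a *+ inv_same b' (pos p) (pos p.+1) * f b'.
  by rewrite /F /opSn /opS ffunE.
(* The bound [c] will be the color of b in position p for [G1] and in position p + 1 for [G2]. *)
have F0 b' c : (forall i : 'I_n, (i < p)%N -> color b' i = color b i) ->
    (color b (pos p) <= c < color b' (pos p.+1))%N -> F b' = 0.
  move=> b'L /andP[cb cb']; rewrite FE [f (s b')]f0; last 2 first.
  - by move=> i ip; rewrite colL ?b'L.
  - by rewrite colP; lia.
  rewrite /inv_same; case: eqP => [e|_]; last by rewrite mul0r addr0.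
  by rewrite [f b']f0 ?mulr0 ?addr0 //; lia.
have G1 : opY l p.+1 F (s b) = F (s b).
  apply: IHl => [|b' b'L]; first lia.
  rewrite colQ => h; apply: (F0 b' (color b (pos p))) => [i ip|].
    by rewrite b'L ?colL // ltnW.
  by rewrite leqnn.
have rc := @rank_color _ _ b (pos p.+1) (pos p).
have G2 : (rank b (pos p) < rank b (pos p.+1))%N -> opY l p.+1 F b = F b.
  move=> rpq; apply: IHl => [|b' b'L h]; first lia.
  apply: (F0 b' (color b (pos p.+1))) => [i ip|]; first by rewrite b'L // ltnW.
  rewrite h andbT leqNgt; apply/negP => /rc; lia.
(* If the letters in positions p and p + 1 of b are inverted, the diagonal coefficient of T_p^-1 at
   b is a - a = 0 and only the value at [s b] counts. Hence [G2] is needed for the other order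
   only. *)
rewrite /opVn /opV !ffunE -/(s b) -[a *: _]/(a * _) G1 FE ss.
rewrite /inv_all /inv_same colP colQ !rank_perm tpermL tpermR.
move: (rank_neq b pq) G2.
case: (ltngtP (rank b (pos p)) (rank b (pos p.+1))) => // rpq _ G2; last first.
  by rewrite andbF mulr0n mulr1n; ring.
rewrite mulr0n G2 // FE /inv_same [(rank b _ < _)%N]ltnNge (ltnW rpq).
rewrite andbF andbT.
(* For equal colors the two terms in f (s b) cancel. For different colors only -a f (s b) is left,
   which [f0] kills. *)
case: eqP => [_|ne]; rewrite ?mulr0n ?mulr1n; first by ring.
rewrite [f (s b)]f0; first by ring.
- by move=> i ip; rewrite colL.
- rewrite colP; move: (@rank_color _ _ b (pos p.+1) (pos p)); lia.
Qed.

Lemma opZ_diag f b :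
    (forall b', (color b (pos 0) < color b' (pos 0))%N -> f b' = 0) ->
  opZ f b = u (color b (pos 0)) * f b.
Proof.
move=> f0; rewrite /opZ opY_diag ?ffunE // => b' _ h.
by rewrite ffunE f0 ?mulr0.
Qed.

Definition evalZ (P : {poly D}) f : M := \sum_(i < size P) P`_i *: iter i opZ f.

Lemma evalZE k (P : {poly D}) f : (size P <= k)%N ->
  evalZ P f = \sum_(i < k) P`_i *: iter i opZ f.
Proof.
move=> Pk; rewrite /evalZ (big_ord_widen _ (fun i => P`_i *: iter i opZ f) Pk).
rewrite big_mkcond; apply: eq_bigr => i _; case: ltnP => // le.
by rewrite nth_default // scale0r.
Qed.

Lemma evalZ_is_linear c P Q f :
  evalZ (c *: P + Q) f = c *: evalZ P f + evalZ Q f.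
Proof.
pose k := maxn (size P) (size Q).
have szP : (size P <= k)%N by rewrite leq_maxl.
have szQ : (size Q <= k)%N by rewrite leq_maxr.
have sz : (size (c *: P + Q)%R <= k)%N.
  rewrite (leq_trans (size_polyD _ _)) // geq_max szQ andbT.
  exact: leq_trans (size_scale_leq _ _) szP.
rewrite (evalZE _ szP) (evalZE _ szQ) (evalZE _ sz) scaler_sumr -big_split.
by apply: eq_bigr => i _ /=; rewrite coefD coefZ scalerDl scalerA.
Qed.

Lemma evalZXn k f : evalZ 'X^k f = iter k opZ f.
Proof.
rewrite /evalZ size_polyXn big_ord_recr big1 /= => [|i _].
  by rewrite coefXn eqxx scale1r add0r.
by rewrite coefXn ltn_eqF // scale0r.
Qed.

Lemma iterZ_linear i : linear (iter i opZ).
Proof. by elim: i => [//|i IHi] c f1 f2; rewrite !iterS IHi linearP. Qed.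

Lemma evalZ0 P : evalZ P 0 = 0.
Proof.
rewrite /evalZ big1 // => i _.
suff -> : iter i opZ 0 = 0 by rewrite scaler0.
by elim: {+}(val i) => [//|j IHj]; rewrite iterSr linear0.
Qed.

Lemma evalZ_mulXsubC P c f :
  evalZ (P * ('X - c%:P)) f = evalZ P (opZ f - c *: f).
Proof.
have sz : (size (P * ('X - c%:P))%R <= (size P).+1)%N.
  by rewrite (leq_trans (size_polyMleq _ _)) // size_XsubC addn2.
rewrite (evalZE _ sz).
have E i : (P * ('X - c%:P))`_i = (P * 'X)`_i - c * P`_i.
  by rewrite mulrBr coefB coefMC [_ * c]mulrC.
under eq_bigr do rewrite E scalerBl.
rewrite sumrB big_ord_recl big_ord_recr /= [P`_(size P)]nth_default //.
rewrite coefMX /= scale0r add0r mulr0 scale0r addr0 -sumrB.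
apply: eq_bigr => i _; rewrite coefMX /= -iterS iterSr.
rewrite [opZ f - _]addrC -(scaleNr c f) iterZ_linear scalerDr scalerA addrC.
by rewrite mulrN scaleNr [c * _]mulrC.
Qed.

(** By [opZ_diag], if the first colors in the support of f are at most k, then Z - u_k kills the
    part of color k and creates none of larger color. Each factor thus lowers the bound by one. *)
Lemma evalZ_triangular k f : (forall b, (k <= color b (pos 0))%N -> f b = 0) ->
  evalZ (\prod_(j < k) ('X - (u j)%:P)) f = 0.
Proof.
elim: k f => [|k IHk] f f0.
  by have -> : f = 0; [apply/ffunP => b; rewrite f0 ?ffunE | rewrite evalZ0].
rewrite big_ord_recr evalZ_mulXsubC IHk // => b; rewrite leq_eqVlt => kb.
rewrite !ffunE opZ_diag => [|b' h]; last by rewrite f0 //; lia.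
case/orP: kb => [/eqP->|kb]; first by rewrite -[u _ *: _]/(u _ * _) subrr.
by rewrite (f0 b) // scaler0 mulr0 subr0.
Qed.

Lemma evalZ_eq0 f : evalZ (\prod_(j < d) ('X - (u j)%:P)) f = 0.
Proof.
apply: evalZ_triangular => b; rewrite leqNgt => /negP[].
exact: ltn_ord.
Qed.

(* Generator number 0 is z and generator number g > 0 is s_{g+1}, which acts on
   the letters in positions g - 1 and g. *)
Definition gen_op (g : nat) : M -> M := if g is k.+1 then opTn k else opZ.

Lemma gen_op_is_linear g : linear (gen_op g).
Proof. by case: g => [|k] c f1 f2 /=; rewrite linearP. Qed.

HB.instance Definition _ g :=
  GRing.isLinear.Build D M M _ (gen_op g) (gen_op_is_linear g).

End ArikiTerasomaYamada.

(** * The action of the Hecke algebra *)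

Section HeckeModule.
Context (d m : nat) (D : comNzRingType) (a : D) (u : nat -> D).
Context (phi : {rmorphism R0 d -> D}).
Local Notation n := m.+1.
Local Notation M := {ffun cword d n -> D^o}.
Implicit Types (f : M) (b : cword d n).
Local Notation free := (freealg (R0 d) (hecke_gen n)).

Definition word_op (w : fmonom (hecke_gen n)) f : M :=
  foldr (fun g : 'I_n => gen_op a u g) f w.

Lemma word_op_is_linear w : linear (word_op w).
Proof.
rewrite /word_op => c f1 f2.
by elim: (w : seq _) => [//|g s IHs] /=; rewrite IHs linearP.
Qed.

HB.instance Definition _ w :=
  GRing.isLinear.Build D M M _ (word_op w) (word_op_is_linear w).

(** The extension of [word_op] along [phi], taken coordinate by coordinate so that the values lie in
    the ring [D]. *)
Definition free_act (x : free) f : M :=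
  [ffun b => monalg.mmap phi (fun w => word_op w f b) x].

Lemma free_actU c w f : free_act (mkmalgU w c) f = phi c *: word_op w f.
Proof. by apply/ffunP => b; rewrite !ffunE monalg.mmapU. Qed.

Lemma free_actB x y f : free_act (x - y) f = free_act x f - free_act y f.
Proof. by apply/ffunP => b; rewrite !ffunE monalg.mmapB. Qed.

Lemma free_actD x y f : free_act (x + y) f = free_act x f + free_act y f.
Proof. by apply/ffunP => b; rewrite !ffunE monalg.mmapD. Qed.

Lemma free_act_sum (I : Type) (r : seq I) (P : pred I) (F : I -> free) f :
  free_act (\sum_(i <- r | P i) F i) f = \sum_(i <- r | P i) free_act (F i) f.
Proof.
apply/ffunP => b; rewrite sum_ffunE !ffunE raddf_sum /=.
by apply: eq_bigr => i _; rewrite ffunE.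
Qed.

Lemma free_act_linear x : linear (free_act x).
Proof.
move=> c f1 f2; apply/ffunP => b; rewrite !ffunE !monalg.mmapE.
rewrite scaler_sumr -big_split; apply: eq_bigr => k _ /=.
by rewrite linearP !ffunE mulrDr -[c *: _]/(c * _) -[c *: _]/(c * _) mulrCA.
Qed.

HB.instance Definition _ x :=
  GRing.isLinear.Build D M M _ (free_act x) (free_act_linear x).

Lemma free_actM x y f : free_act (x * y) f = free_act x (free_act y f).
Proof.
rewrite {1}(monalgE y) [in RHS](monalgE y) {1}(monalgE x) [in RHS](monalgE x).
rewrite mulr_suml !free_act_sum; apply: eq_bigr => w _.
rewrite mulr_sumr !free_act_sum linear_sum; apply: eq_bigr => w' _.
rewrite /= malgM_def fgmulUU !free_actU linearZ_LR scalerA rmorphM.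
by congr (_ *: _); rewrite /word_op fmM foldr_cat.
Qed.

Lemma free_actZ c x f : free_act (c *: x) f = phi c *: free_act x f.
Proof.
rewrite {1}(monalgE x) [in RHS](monalgE x) scaler_sumr !free_act_sum.
rewrite scaler_sumr; apply: eq_bigr => w _.
rewrite !free_actU scalerA -rmorphM -free_actU; congr (free_act _ _).
by rewrite -mul_malgC malgM_def fgmulUU mul1m.
Qed.

Lemma free_act1 f : free_act 1 f = f.
Proof. by rewrite free_actU rmorph1 scale1r /word_op fm1. Qed.

(** A relation, so that the operator of a relator can be assembled along its syntax. *)
Definition acts_as (x : free) (F : M -> M) : Prop :=
  forall f, free_act x f = F f.

Lemma acts_asM x y F G : acts_as x F -> acts_as y G -> acts_as (x * y) (F \o G).
Proof. by move=> xF yG f; rewrite free_actM yG xF. Qed.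

Lemma acts_asB x y F G : acts_as x F -> acts_as y G ->
  acts_as (x - y) (fun f => F f - G f).
Proof. by move=> xF yG f; rewrite free_actB yG xF. Qed.

Lemma acts_asZ c x F : acts_as x F -> acts_as (c *: x) (fun f => phi c *: F f).
Proof. by move=> xF f; rewrite free_actZ xF. Qed.

Lemma acts_asX x F k : acts_as x F -> acts_as (x ^+ k) (iter k F).
Proof.
move=> xF; elim: k => [|k IHk] f; first by rewrite expr0 free_act1.
by rewrite exprS (acts_asM xF IHk).
Qed.

Lemma acts_as_z : acts_as (free_z d n) (opZ a u).
Proof. by move=> f; rewrite free_actU rmorph1 scale1r /word_op fmuE. Qed.

Lemma acts_as_s j : (2 <= j <= n)%N -> acts_as (free_s d n j) (opTn a j.-2).
Proof.
move=> jn f; rewrite free_actU rmorph1 scale1r /word_op fmuE /=.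
rewrite inordK; last lia.
by case: j jn => [|[|j]].
Qed.

Hypothesis m_gt0 : (0 < m)%N.
Hypothesis phi_a : phi (par_a d) = a.
Hypothesis phi_b : \prod_(j < d) ('X - (u j)%:P) =
  'X^d - \sum_(1 <= i < d) phi (par_b d i) *: 'X^(d - i) - 1.

Lemma hecke_rel_acts x : hecke_rel x -> acts_as x (fun=> 0).
Proof.
have az := acts_as_z; have as_ := acts_as_s.
case=> [|j jn|i iN|i j iN jn ij||j jn] f.
- have a2 : acts_as (free_s d n 2) (opTn a 0) by apply: as_; lia.
  rewrite (acts_asB (acts_asM (acts_asM (acts_asM az a2) az) a2)
                    (acts_asM (acts_asM (acts_asM a2 az) a2) az)) /=.
  by rewrite opZ_reflection ?subrr.
- have aj : acts_as (free_s d n j) (opTn a j.-2) by apply: as_; lia.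
  rewrite (acts_asB (acts_asM az aj) (acts_asM aj az)) /= opZ_T ?subrr //.
  lia.
- have aj : acts_as (free_s d n i) (opTn a i.-2) by apply: as_; lia.
  have ai : acts_as (free_s d n i.+1) (opTn a i.-2.+1).
    by have -> : i.-2.+1 = i.+1.-2; [lia | apply: as_; lia].
  rewrite (acts_asB (acts_asM (acts_asM aj ai) aj)
                    (acts_asM (acts_asM ai aj) ai)) /= opTn_braid ?subrr //.
  lia.
- have ai : acts_as (free_s d n i) (opTn a i.-2) by apply: as_; lia.
  have aj : acts_as (free_s d n j) (opTn a j.-2) by apply: as_; lia.
  rewrite (acts_asB (acts_asM ai aj) (acts_asM aj ai)) /= opTn_opTn ?subrr //.
  rewrite /disjoint_pos; lia.
- have a1 : acts_as 1 id := free_act1.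
  have aS : acts_as (\sum_(1 <= i < d) par_b d i *: free_z d n ^+ (d - i))
      (fun f => \sum_(1 <= i < d) phi (par_b d i) *: iter (d - i) (opZ a u) f).
    move=> g; rewrite free_act_sum; apply: eq_bigr => i _.
    exact: (acts_asZ _ (acts_asX _ az)).
  rewrite (acts_asB (acts_asB (acts_asX d az) aS) a1).
  (* The 0 on the right is P(Z) f for the product P of all X - u_j, which [phi_b] identifies with
     the polynomial of z. *)
  rewrite -[RHS](evalZ_eq0 a u f) phi_b.
  have eB P Q : evalZ a u (P - Q) f = evalZ a u P f - evalZ a u Q f.
    by rewrite addrC -scaleN1r evalZ_is_linear scaleN1r addrC.
  rewrite !eB evalZXn -(expr0 'X) evalZXn; congr (_ - _ - _).
  elim/big_rec2: _ => [|i g P _ ->].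
    by have := eB 0 0; rewrite !subrr => ->.
  by rewrite evalZ_is_linear evalZXn.
- have aj : acts_as (free_s d n j) (opTn a j.-2) by apply: as_; lia.
  have a1 : acts_as 1 id := free_act1.
  have aj2 : acts_as (free_s d n j ^+ 2) _ := acts_asX 2 aj.
  rewrite (acts_asB (acts_asB aj2 (acts_asZ (par_a d) aj)) a1) /= phi_a.
  by rewrite opTn_quad; [rewrite addrAC addrK subrr | lia].
Qed.

Local Open Scope quotient_scope.

Lemma ideal_acts x : ideal_gen (@hecke_rel d n) x -> acts_as x (fun=> 0).
Proof.
move=> H; apply: (H (fun y => acts_as y (fun=> 0))); last exact: hecke_rel_acts.
split=> [f|x1 x2 a1 a2 f|y x1 a1 f|x1 y a1 f].
- by rewrite -(subrr 1) free_actB subrr.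
- by rewrite free_actB a1 a2 subrr.
- by rewrite free_actM a1 linear0.
- by rewrite free_actM a1.
Qed.

(** The choice of representative does not matter: two of them differ by an element of the ideal,
    which acts as 0. *)
Definition hecke_act (x : hecke d n) f : M :=
  free_act (generic_quotient.repr x) f.

Lemma hecke_act_proj x f :
  hecke_act (quot_proj (@hecke_rel d n) x) f = free_act x f.
Proof.
apply/eqP; rewrite -subr_eq0 -free_actB; apply/eqP.
by apply: ideal_acts; apply/quot_proj_eq; rewrite /quot_proj reprK.
Qed.

Lemma hecke_actD x y f : hecke_act (x + y) f = hecke_act x f + hecke_act y f.
Proof.
have [[x' ->] [y' ->]] := (quot_proj_surj x, quot_proj_surj y).
by rewrite -raddfD !hecke_act_proj free_actD.
Qed.

Lemma hecke_actZ c x f : hecke_act (c *: x) f = phi c *: hecke_act x f.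
Proof.
have [x' ->] := quot_proj_surj x.
by rewrite -linearZ !hecke_act_proj free_actZ.
Qed.

Lemma hecke_actM x y f : hecke_act (x * y) f = hecke_act x (hecke_act y f).
Proof.
have [[x' ->] [y' ->]] := (quot_proj_surj x, quot_proj_surj y).
by rewrite -rmorphM !hecke_act_proj free_actM.
Qed.

Lemma hecke_act1 f : hecke_act 1 f = f.
Proof. by rewrite -(rmorph1 (quot_proj _)) hecke_act_proj free_act1. Qed.

Lemma hecke_act0 f : hecke_act 0 f = 0.
Proof. by rewrite -(scale0r 0) hecke_actZ rmorph0 scale0r. Qed.

Lemma hecke_act_sum (I : Type) (r : seq I) (P : pred I) F f :
  hecke_act (\sum_(i <- r | P i) F i) f = \sum_(i <- r | P i) hecke_act (F i) f.
Proof.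
by apply: (big_morph (hecke_act^~ f)) => [x y|];
  [exact: hecke_actD | exact: hecke_act0].
Qed.

Lemma hecke_act_z f : hecke_act (hecke_z d n) f = opZ a u f.
Proof. by rewrite hecke_act_proj acts_as_z. Qed.

Lemma hecke_act_s j f : (2 <= j <= n)%N ->
  hecke_act (hecke_s d n j) f = opTn a j.-2 f.
Proof. by move=> jn; rewrite hecke_act_proj acts_as_s. Qed.

End HeckeModule.

(** * The cyclic vector at a = 0 *)

Section Cyclic.
Context (d m : nat) (K : fieldType) (u : nat -> K).
Local Notation n := m.+1.
Local Notation M := {ffun cword d n -> K^o}.
Local Notation pos k := (inord k : 'I_n).
Implicit Types (f : M) (b : cword d n) (i j k : nat).

(** The sum of all colorings of the identity word, over an arbitrary ring so that it can be
    specialized. *)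
Definition cyclic_vector (D : comNzRingType) : {ffun cword d n -> D^o} :=
  [ffun b : cword d n => (b.2 == 1%g)%:R].

Definition perm_op (s : 'S_n) f : M := [ffun b => f (permw s b)].

Lemma opTn0 k f : opTn 0 k f = perm_op (tperm (pos k) (pos k.+1)) f.
Proof. by apply/ffunP => b; rewrite !ffunE mul0rn mul0r addr0. Qed.

Lemma opSn0 k f : opSn 0 k f = perm_op (tperm (pos k) (pos k.+1)) f.
Proof. by apply/ffunP => b; rewrite !ffunE mul0rn mul0r addr0. Qed.

Lemma opVn0 k f : opVn 0 k f = opTn 0 k f.
Proof. by rewrite /opVn /opV scale0r subr0. Qed.

Lemma perm_opM s t f : perm_op s (perm_op t f) = perm_op (t * s) f.
Proof. by apply/ffunP => b; rewrite !ffunE permwM. Qed.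

Lemma perm_op1 f : perm_op 1 f = f.
Proof. by apply/ffunP => b; rewrite ffunE permw1. Qed.

Lemma opY0 l p f : opY 0 l p f = f.
Proof.
elim: l p f => [//|l IHl] p f /=.
by rewrite IHl opVn0 opTn0 opSn0 perm_opM tperm2 perm_op1.
Qed.

Lemma opZ0 f : opZ 0 u f = opPn u 0 f.
Proof. by rewrite /opZ opY0. Qed.

Hypothesis u_inj : {in gtn d &, injective u}.
Variable U : M -> Prop.
Hypothesis U_lin : forall c f g, U f -> U g -> U (c *: f + g).
Hypothesis U_T : forall k f, (k < m)%N -> U f -> U (opTn 0 k f).
Hypothesis U_Z : forall f, U f -> U (opZ 0 u f).
Hypothesis U_cyc : U (cyclic_vector K).

Let U0 : U 0.
Proof. by rewrite -(addNr (cyclic_vector K)) -scaleN1r; apply: U_lin. Qed.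

Let U_scale c f : U f -> U (c *: f).
Proof. by move=> Uf; rewrite -[_ *: _]addr0; apply: U_lin. Qed.

(** Adjacent transpositions suffice: any other transposition is conjugate, by an adjacent one, to a
    transposition of closer positions. *)
Let U_perm s f : U f -> U (perm_op s f).
Proof.
have U_adj k g : (k < m)%N -> U g -> U (perm_op (tperm (pos k) (pos k.+1)) g).
  by move=> km Ug; rewrite -opTn0; exact: U_T.
have U_tperm k l g : (k + l < n)%N -> U g ->
    U (perm_op (tperm (pos k) (pos (k + l))) g).
  elim: l g => [|l IHl] g kl Ug; first by rewrite addn0 tperm1 perm_op1.
  case: l IHl kl => [|l] IHl kl.
    by rewrite addn1; apply: U_adj => //; lia.
  rewrite [(k + l.+2)%N]addnS in kl *; set q := (k + l.+1)%N.
  have -> : tperm (pos k) (pos q.+1) =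
      (tperm (pos q) (pos q.+1) * tperm (pos k) (pos q)
      * tperm (pos q) (pos q.+1))%g.
    rewrite -[X in (X * _ * _)%g]tpermV -mulgA -/(conjg _ _) tpermJ tpermL.
    by rewrite tpermD // pos_eq; lia.
  by rewrite -!perm_opM; apply/U_adj/IHl/U_adj; rewrite // ltnW.
have [ts -> _] := prod_tpermP s; elim: ts f => [|[i j] ts IHts] f Uf.
  by rewrite big_nil perm_op1.
rewrite big_cons -perm_opM; apply: (IHts _) => /=.
wlog ij : i j / (i <= j)%N => [H|].
  by case: (leqP i j) => [/H //|/ltnW/H]; rewrite tpermC.
rewrite -[i]inord_val -[j]inord_val -(subnKC ij); apply: U_tperm => //.
by rewrite subnKC.
Qed.

(** At a = 0, Z is P at position 0, and adjacent transpositions conjugate it to the other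
    positions. *)
Let U_P k f : (k < n)%N -> U f -> U (opPn u k f).
Proof.
elim: k f => [|k IHk] f kn Uf; first by rewrite -opZ0; exact: U_Z.
pose t := tperm (pos k) (pos k.+1).
have -> : opPn u k.+1 f = perm_op t (opPn u k (perm_op t f)).
  apply/ffunP => b; rewrite !ffunE color_perm tpermL.
  by rewrite permwM tperm2 permw1.
by apply/U_perm/IHk/U_perm => //; exact: ltnW.
Qed.

(** Lagrange interpolation: the product of (P_i - u_j) / (u_c - u_j) over the colors j other than c
    projects onto the words with color c in position i. *)
Let U_proj (i : 'I_n) (c : 'I_d) f : U f ->
  U [ffun b : cword d n => (b.1 i == c)%:R * f b].
Proof.
move=> Uf; pose s := [seq j <- iota 0 d | j != c :> nat].
pose g r : M := [ffun b : cword d n =>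
  (\prod_(j <- r) (u (color b i) - u j)) * f b].
have Us : U (g s).
  elim: s => [|j s IHs].
    suff -> : g [::] = f by [].
    by apply/ffunP => b; rewrite ffunE big_nil mul1r.
  suff -> : g (j :: s) = (- u j) *: g s + opPn u i (g s).
    by apply: U_lin => //; apply: U_P.
  apply/ffunP => b; rewrite !ffunE big_cons inord_val.
  by rewrite -[_ *: _]/(_ * _); ring.
have nz : \prod_(j <- s) (u c - u j) != 0.
  rewrite prodf_seq_neq0; apply/allP => j; rewrite mem_filter mem_iota add0n /=.
  move=> /andP[jc jd]; rewrite subr_eq0.
  apply: contra jc => /eqP/u_inj -> //; exact: ltn_ord.
have := U_scale (\prod_(j <- s) (u c - u j))^-1 Us; congr U.
apply/ffunP => b; rewrite !ffunE -[_ *: _]/(_ * _) mulrA /color.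
have [->|bc] := eqVneq (b.1 i) c; first by rewrite mulVf.
have us : uniq s by rewrite filter_uniq ?iota_uniq.
have bs : val (b.1 i) \in s.
  by rewrite mem_filter mem_iota /= add0n ltn_ord andbT.
have -> : \prod_(j <- s) (u (b.1 i) - u j) = 0.
  by rewrite (bigD1_seq _ bs us) /= subrr mul0r.
by rewrite mulr0 !mul0r.
Qed.

(** Projecting the cyclic vector at every position isolates one coloring of the identity word;
    permutations then reach all words. *)
Lemma cyclic_vector_generates f : U f.
Proof.
pose delta b0 : M := [ffun b => (b == b0)%:R].
have U_delta1 (c : {ffun 'I_n -> 'I_d}) : U (delta (c, 1%g)).
  pose g (s : seq 'I_n) : M := [ffun b : cword d n =>
    (all (fun i : 'I_n => b.1 i == c i) s)%:R * cyclic_vector K b].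
  have Us s : U (g s).
    elim: s => [|i s IHs].
      suff -> : g [::] = cyclic_vector K by [].
      by apply/ffunP => b; rewrite [LHS]ffunE mul1r.
    have := U_proj i (c i) IHs; congr U; apply/ffunP => b.
    by rewrite !ffunE /=; case: eqP => _; rewrite ?mul1r ?mul0r.
  have := Us (enum 'I_n); congr U; apply/ffunP => b; rewrite !ffunE.
  rewrite -natrM mulnb; congr (_%:R); case: b => c' w; rewrite xpair_eqE.
  congr (nat_of_bool (_ && _)); apply/allP/eqP => [E|-> //].
  by apply/ffunP => i; apply/eqP/E; rewrite mem_enum.
have U_delta b0 : U (delta b0).
  case: b0 => c w; have := U_perm w^-1 (U_delta1 (permw w^-1 (c, w)).1).
  congr U; apply/ffunP => b; rewrite !ffunE; congr ((nat_of_bool _)%:R).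
  have -> : ((permw w^-1 (c, w)).1, 1%g) = permw w^-1 (c, w).
    by rewrite /permw /= mulVg.
  apply: (can_eq (g := permw w)) => b'.
  by rewrite permwM mulgV permw1.
have -> : f = \sum_b f b *: delta b.
  apply/ffunP => b; rewrite sum_ffunE (bigD1 b) //= big1 => [|b' b'b].
    by rewrite !ffunE eqxx addr0 -[_ *: _]/(_ * _) mulr1.
  by rewrite !ffunE eq_sym (negbTE b'b) scaler0.
elim/big_rec: _ => [//|b g _ Ug]; exact: U_lin.
Qed.

End Cyclic.

(** * Change of the ground ring *)

Section ScalarExtension.
Context (d m : nat) (D E : comNzRingType) (psi : {rmorphism D -> E}).
Context (a : D) (u : nat -> D).
Local Notation n := m.+1.
Local Notation M := {ffun cword d n -> D^o}.
Implicit Types (f : M).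

Definition map_vect f : {ffun cword d n -> E^o} := [ffun b => psi (f b)].

Lemma map_opTn k f : map_vect (opTn a k f) = opTn (psi a) k (map_vect f).
Proof. by apply/ffunP => b; rewrite !ffunE rmorphD rmorphM rmorphMn. Qed.

Lemma map_opSn k f : map_vect (opSn a k f) = opSn (psi a) k (map_vect f).
Proof. by apply/ffunP => b; rewrite !ffunE rmorphD rmorphM rmorphMn. Qed.

Lemma map_opVn k f : map_vect (opVn a k f) = opVn (psi a) k (map_vect f).
Proof.
rewrite /opVn /opV -/(opTn (psi a) k (map_vect f)) -map_opTn; apply/ffunP => b.
by rewrite !ffunE rmorphB -![_ *: _]/(_ * _) rmorphM.
Qed.

Lemma map_opZ f : map_vect (opZ a u f) = opZ (psi a) (psi \o u) (map_vect f).
Proof.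
have YE l p g : map_vect (opY a l p g) = opY (psi a) l p (map_vect g).
  by elim: l p g => [//|l IHl] p g /=; rewrite map_opVn IHl map_opSn.
rewrite /opZ YE; congr opY; apply/ffunP => b.
by rewrite !ffunE rmorphM.
Qed.

End ScalarExtension.

(** * Spanning *)

Section Span.
Context (R : pzRingType) (V : lmodType R).
Implicit Types (P Q : V -> Prop) (x y : V).

(** Inductive, so that stability under a linear map is checked on generators by [span_morph]. *)
Inductive span P : V -> Prop :=
| span0 : span P 0
| span_cons c x y : P x -> span P y -> span P (c *: x + y).

Lemma span_gen P x : P x -> span P x.
Proof.
by move=> Px; rewrite -[x]addr0 -[x]scale1r; apply: span_cons => //; left.
Qed.

Lemma spanD P x y : span P x -> span P y -> span P (x + y).
Proof.
by move=> + Py; elim=> [|c x' y' Px' _ IH]; rewrite ?add0r // -addrA; right.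
Qed.

Lemma spanZ P c x : span P x -> span P (c *: x).
Proof.
elim=> [|c' x' y' Px' _ IH]; first by rewrite scaler0; left.
by rewrite scalerDr scalerA; right.
Qed.

Lemma spanB P x y : span P x -> span P y -> span P (x - y).
Proof.
by move=> Px Py; apply: spanD => //; rewrite -scaleN1r; apply: spanZ.
Qed.

Lemma span_sum P (I : Type) (r : seq I) (C : pred I) (F : I -> V) :
  (forall i, C i -> span P (F i)) -> span P (\sum_(i <- r | C i) F i).
Proof. by move=> PF; elim/big_ind: _ => //; [left | exact: spanD]. Qed.

End Span.

Lemma span_morph (R : pzRingType) (V W : lmodType R) (f : V -> W)
    (P : V -> Prop) (Q : W -> Prop) :
    (forall c x y, f (c *: x + y) = c *: f x + f y) ->
    (forall x, P x -> span Q (f x)) ->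
  forall x, span P x -> span Q (f x).
Proof.
move=> fL PQ x; elim=> [|c x' y' Px' _ IH]; last first.
  by rewrite fL; apply: spanD => //; apply/spanZ/PQ.
(* The coefficient -1 yields f 0 = - f 0 + f 0 = 0. *)
have := fL (-1) 0 0; rewrite scaler0 addr0 scaleN1r addNr => ->; left.
Qed.

(** * Moving z across s_2 z^p s_2 *)

Section Reflection.
Context (R : comPzRingType) (A : algType R) (a : R) (z s : A).
Hypothesis quad : s * s = a *: s + 1.
Hypothesis refl : z * s * z * s = s * z * s * z.

(* With s^-1 = s - a, one has s z^(p+1) s z = (s z^p s z) s z s^-1. *)
Lemma reflectionX p :
  s * z ^+ p.+1 * s * z =
  z * s * z ^+ p.+1 * s + a *: (z ^+ p.+1 * s * z - z * s * z ^+ p.+1).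
Proof.
pose t : A := s - a *: 1.
have st : s * t = 1.
  by rewrite mulrBr quad -scalerAr mulr1 addrC addKr.
elim: p => [|p IHp].
  by rewrite expr1 -refl subrr scaler0 addr0.
have -> : s * z ^+ p.+2 * s * z = (s * z ^+ p.+1 * s * z) * s * z * t.
  rewrite [X in s * X]exprSr -[LHS]mulr1 -st.
  by rewrite -!mulrA; congr (_ * (_ * _)); rewrite !mulrA refl.
have -> : s * z ^+ p.+1 * s * z * s =
    z * s * z ^+ p.+1 + a *: (z ^+ p.+1 * s * z * s).
  rewrite IHp mulrDl -scalerAl mulrBl -[_ * s * s]mulrA quad mulrDr mulr1.
  by rewrite -scalerAr scalerBr [X in _ + X]addrC addrACA subrr add0r.
rewrite mulrDl mulrDl -!scalerAl scalerBr.
have -> : z ^+ p.+1 * s * z * s * z * t = z ^+ p.+2 * s * z.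
  rewrite -[RHS]mulr1 -st [in RHS]exprSr -!mulrA; congr (_ * _).
  by rewrite !mulrA refl.
have -> : z * s * z ^+ p.+1 * z * t =
    z * s * z ^+ p.+2 * s - a *: (z * s * z ^+ p.+2).
  by rewrite -[_ * z]mulrA -exprSr mulrBr -scalerAr mulr1.
by rewrite addrAC addrA.
Qed.

End Reflection.

(** * Spanning in any algebra that satisfies the Hecke relations *)

Section AbstractSpanning.
Context (R : comPzRingType) (A : algType R) (d n : nat).
Context (a : R) (c : nat -> R) (z : A) (s_ : nat -> A).
Local Notation s := s_.
Implicit Types (i j k p : nat).

Hypothesis zszs : z * s 2 * z * s 2 = s 2 * z * s 2 * z.
Hypothesis zs : forall j, (3 <= j <= n)%N -> z * s j = s j * z.
Hypothesis braid : forall i, (2 <= i < n)%N ->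
  s i * s i.+1 * s i = s i.+1 * s i * s i.+1.
Hypothesis ss : forall i j, (2 <= i <= n)%N -> (2 <= j <= n)%N ->
  (i.+1 < j)%N || (j.+1 < i)%N -> s i * s j = s j * s i.
Hypothesis zd : z ^+ d = \sum_(1 <= i < d) c i *: z ^+ (d - i) + 1.
Hypothesis quad : forall j, (2 <= j <= n)%N -> s j * s j = a *: s j + 1.

Definition down i j : A := \prod_(k <- rev (index_iota j i.+1)) s k.
Definition up i j : A := \prod_(i <= k < j.+1) s k.

Lemma downS i j : (j <= i.+1)%N -> down i.+1 j = s i.+1 * down i j.
Proof.
move=> ji; rewrite /down /index_iota subSn // -addn1 iotaD rev_cat big_cat.
by rewrite /= big_seq1 subnKC.
Qed.

Lemma down_recr i j : (j <= i)%N -> down i j = down i j.+1 * s j.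
Proof.
move=> ji; rewrite /down /index_iota subSn //= rev_cons -cats1 big_cat.
by rewrite big_seq1 subSS.
Qed.

Lemma down_geq i j : (i < j)%N -> down i j = 1.
Proof. by move=> ij; rewrite /down /index_iota (eqP ij) big_nil. Qed.

Lemma upS i j : (i <= j.+1)%N -> up i j.+1 = up i j * s j.+1.
Proof. by move=> ij; rewrite /up big_nat_recr. Qed.

Lemma up_geq i j : (j < i)%N -> up i j = 1.
Proof. by move=> ij; rewrite /up big_geq. Qed.

Lemma down_comm i j (x : A) :
    (forall k, (j <= k <= i)%N -> x * s k = s k * x) ->
  x * down i j = down i j * x.
Proof.
move=> xs; rewrite /down big_seq; apply: commr_prod => k.
by rewrite mem_rev mem_index_iota ltnS => /xs.
Qed.

Lemma up_comm i j (x : A) :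
    (forall k, (i <= k <= j)%N -> x * s k = s k * x) ->
  x * up i j = up i j * x.
Proof.
move=> xs; rewrite /up big_nat; apply: commr_prod => k.
by rewrite ltnS => /xs.
Qed.

Lemma z_comm p j : (3 <= j <= n)%N -> z ^+ p * s j = s j * z ^+ p.
Proof. by move=> jn; apply/esym/commrX/esym/zs. Qed.

Lemma z_down p i j : (3 <= j)%N -> (i <= n)%N ->
  z ^+ p * down i j = down i j * z ^+ p.
Proof. by move=> j3 iN; apply: down_comm => k jk; apply: z_comm; lia. Qed.

Lemma z_up p i j : (3 <= i)%N -> (j <= n)%N ->
  z ^+ p * up i j = up i j * z ^+ p.
Proof. by move=> j3 iN; apply: up_comm => k jk; apply: z_comm; lia. Qed.

(** Moving left, s_j meets s_j s_{j-1}; the braid relation lets s_{j-1} come out, which commutes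
    with the factors further left. *)
Lemma down_s i i' j : (2 <= i')%N -> (i' < j <= i)%N -> (i <= n)%N ->
  down i i' * s j = s j.-1 * down i i'.
Proof.
move=> i2 /andP[ij ji]; elim: i ji => [|i IHi] ji iN; first by lia.
rewrite downS; last lia.
have [ji'|ji'] := leqP j i.
  by rewrite -mulrA IHi ?mulrA ?(@ss i.+1 j.-1) //; lia.
have ej : j = i.+1 by lia.
subst j; case: i ij IHi {ji ji'} iN => [|i] ij IHi iN; first by lia.
rewrite downS; last lia.
rewrite -!mulrA -down_comm => [|k kb]; last by apply: ss; lia.
by rewrite !mulrA braid //; lia.
Qed.

Lemma up_s i' j : (2 <= j < i')%N -> (i' <= n)%N ->
  up 2 i' * s j = s j.+1 * up 2 i'.
Proof.
move=> /andP[j2 ji]; elim: i' ji => [//|i IHi] ji iN.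
rewrite upS; last lia.
have [ji'|ji'] := ltnP j i.
  by rewrite -mulrA ss ?mulrA ?IHi -?mulrA //; lia.
have ej : j = i by lia.
subst j; case: i IHi {ji ji'} j2 iN => [//|i] IHi j2 iN.
rewrite upS; last lia.
rewrite -!mulrA [X in _ * X]mulrA braid; last lia.
rewrite !mulrA; congr (_ * _ * _).
by apply/esym/up_comm => k kb; apply: ss; lia.
Qed.

Lemma down_up i k : (2 <= i <= k)%N -> (k <= n)%N ->
  down k 2 * up 3 i = up 2 i.-1 * down k 2.
Proof.
move=> + kn; elim: i => [//|i IHi] ik; case: (eqVneq i 1%N) ik => [->|i1] ik.
  by rewrite !up_geq // mulr1 mul1r.
rewrite upS; last lia.
rewrite mulrA IHi; last lia.
case: i i1 ik {IHi} => [|i] i1 ik; first lia.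
by rewrite /= upS -?mulrA ?down_s //; lia.
Qed.

(** Level 0 has no generator, so that H_0 consists of scalars and the induction starts before
    Lambda_1. *)
Definition generator k (g : A) : Prop :=
  ((1 <= k)%N /\ g = z) \/ (exists2 j, (2 <= j <= k)%N & g = s j).

Inductive word k : A -> Prop :=
| word1 : word k 1
| wordM x g : word k x -> generator k g -> word k (x * g).

Lemma word_mul k x y : word k x -> word k y -> word k (x * y).
Proof.
by move=> kx; elim=> [|y' g _ IH kg]; rewrite ?mulr1 // mulrA; apply: wordM.
Qed.

Lemma word_gen k g : generator k g -> word k g.
Proof. by move=> kg; rewrite -[g]mul1r; apply: wordM => //; apply: word1. Qed.

Lemma word_s k j : (2 <= j <= k)%N -> word k (s j).
Proof. by move=> jk; apply: word_gen; right; exists j. Qed.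

Lemma word_zX k p : (1 <= k)%N -> word k (z ^+ p).
Proof.
move=> k1; elim: p => [|p IHp]; first exact: word1.
by rewrite exprSr; apply: wordM => //; left.
Qed.

Lemma word_up k i : (i <= k)%N -> word k (up 2 i).
Proof.
elim: i => [|i IHi] ik; first by rewrite up_geq //; apply: word1.
have [i1|i1] := leqP i 0; first by rewrite up_geq //; apply: word1.
rewrite upS //; apply: word_mul; first exact: IHi (ltnW ik).
by apply: word_s; lia.
Qed.

(* Convertible to Lambda_ when A is the Hecke algebra. *)
Definition coset_reps i : seq A :=
  if i == 1%N then [seq z ^+ k | k <- index_iota 0 d]
  else [:: 1]
    ++ [seq down i i' | i' <- index_iota 2 i.+1]
    ++ [seq down i 2 * z ^+ k | k <- index_iota 1 d]
    ++ [seq down i 2 * z ^+ k * up 2 i'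
         | k <- index_iota 1 d, i' <- index_iota 2 i.+1].

(** This is the span of H_{k-1} Lambda_k, as H_{k-1} is itself spanned by words. *)
Definition coset_span k : A -> Prop :=
  span (fun x =>
    exists2 h, word k.-1 h & exists2 l, l \in coset_reps k & x = h * l).

Hypothesis d_gt0 : (0 < d)%N.

Lemma zX_span p : span (fun x => exists2 q, (q < d)%N & x = z ^+ q) (z ^+ p).
Proof.
elim: p => [|p IHp]; first by apply: span_gen; exists 0%N.
rewrite exprSr; move: (z ^+ p) IHp.
apply: (span_morph (f := fun x => x * z)) => [e x y|x [q qd ->]].
  by rewrite mulrDl scalerAl.
rewrite -exprSr; have [qd'|qd'] := ltnP q.+1 d.
  by apply: span_gen; exists q.+1.
have -> : q.+1 = d by lia.
rewrite zd; apply: spanD; last by apply: span_gen; exists 0%N.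
rewrite big_nat; apply: span_sum => i ib; apply/spanZ/span_gen.
by exists (d - i)%N => //; lia.
Qed.

Lemma coset_span_mull k h x :
  word k.-1 h -> coset_span k x -> coset_span k (h * x).
Proof.
move=> kh; apply: (span_morph (f := fun x => h * x)) => [e y y'|y].
  by rewrite mulrDr scalerAr.
case=> h' kh' [l lk ->].
apply: span_gen; exists (h * h'); first exact: word_mul.
by exists l; rewrite ?mulrA.
Qed.

Section Closure.
Variable k : nat.
Hypothesis kn : (2 <= k <= n)%N.

Let k1 : k == 1%N = false. Proof. by apply/negP; lia. Qed.

Let span_word h : word k.-1 h -> coset_span k h.
Proof.
move=> kh; apply: span_gen; exists h => //; exists 1; last by rewrite mulr1.
by rewrite /coset_reps k1 mem_head.
Qed.

Let span_down i : (2 <= i <= k.+1)%N -> coset_span k (down k i).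
Proof.
move=> ik; have [ki|ki] := ltnP k i.
  by rewrite down_geq //; apply/span_word/word1.
apply: span_gen; exists 1; first exact: word1.
exists (down k i); last by rewrite mul1r.
rewrite /coset_reps k1 !mem_cat; apply/or4P; apply: Or42; apply/map_f.
by rewrite mem_index_iota; lia.
Qed.

Let span_downz p : coset_span k (down k 2 * z ^+ p).
Proof.
move: (zX_span p); move: (z ^+ p).
apply: (span_morph (f := fun x => down k 2 * x)) => [e x y|x [q qd ->]].
  by rewrite mulrDr scalerAr.
case: q qd => [|q] qd; first by rewrite mulr1; apply: span_down; lia.
apply: span_gen; exists 1; first exact: word1.
exists (down k 2 * z ^+ q.+1); last by rewrite mul1r.
rewrite /coset_reps k1 !mem_cat; apply/or4P; apply: Or43.
by apply: (map_f (fun p => down k 2 * z ^+ p)); rewrite mem_index_iota; lia.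
Qed.

Let span_downzup p i : (1 <= p < d)%N -> (1 <= i <= k)%N ->
  coset_span k (down k 2 * z ^+ p * up 2 i).
Proof.
move=> pd ik; have [i1|i1] := leqP i 1.
  by rewrite up_geq // mulr1; apply: span_downz.
apply: span_gen; exists 1; first exact: word1.
exists (down k 2 * z ^+ p * up 2 i); last by rewrite mul1r.
rewrite /coset_reps k1 !mem_cat; apply/or4P; apply: Or44.
by apply/allpairsP; exists (p, i); rewrite !mem_index_iota; split => //=; lia.
Qed.

(** The value i = k + 1 gives the empty product, hence the representative 1. *)
Let closed_down i g : (2 <= i <= k.+1)%N -> generator k g ->
  coset_span k (down k i * g).
Proof.
move=> ik [[_ ->]|[j jk ->]].
  have [i3|i3] := leqP 3 i; last first.
    have -> : i = 2 by lia.
    by rewrite -[z]expr1; apply: span_downz.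
  rewrite -[z]expr1 -z_down //; last lia.
  by apply: coset_span_mull; [apply: word_zX; lia | apply: span_down].
have [ji|ji] := ltnP j i.
  have [ji'|ji'] := ltnP j.+1 i.
    rewrite -down_comm => [|l lb]; last by apply: ss; lia.
    by apply: coset_span_mull; [apply: word_s; lia | apply: span_down].
  have ei : i = j.+1 by lia.
  by rewrite ei -down_recr; [apply: span_down; lia | lia].
have [ji'|ji'] := ltnP i j.
  rewrite down_s; try lia.
  by apply: coset_span_mull; [apply: word_s; lia | apply: span_down].
have -> : j = i by lia.
rewrite down_recr; last lia.
rewrite -mulrA quad; last lia.
rewrite mulrDr mulr1 -scalerAr -down_recr; last lia.
by apply: spanD; [apply/spanZ/span_down; lia | apply: span_down; lia].
Qed.

Let closed_downz p g : (1 <= p < d)%N -> generator k g ->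
  coset_span k (down k 2 * z ^+ p * g).
Proof.
move=> pd [[_ ->]|[j jk ->]].
  by rewrite -mulrA -exprSr; apply: span_downz.
have [j3|j3] := leqP 3 j; last first.
  have -> : s j = up 2 2 by rewrite /up big_nat1; congr s; lia.
  by apply: span_downzup; lia.
rewrite -mulrA z_comm ?mulrA ?down_s -?mulrA; try lia.
by apply: coset_span_mull; [apply: word_s; lia | apply: span_downz].
Qed.

(** Since z commutes with s_3, ..., s_k, only s_2 z^p s_2 z has to be rewritten, by [reflectionX].
    Its first term releases z on the left. The two terms with coefficient a contain a single s_2,
    and [slide] brings z^q s_2 ... s_{i-1}, an element of H_{k-1}, to the left. *)
Let closed_downzup_z p i : (1 <= p < d)%N -> (2 <= i <= k)%N ->
  coset_span k (down k 2 * z ^+ p * up 2 i * z).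
Proof.
move=> pd ik; set r3 := up 3 i.
have up2 : up 2 i = s 2 * r3 by rewrite /up big_ltn //; lia.
have zr q : z ^+ q * r3 = r3 * z ^+ q by apply: z_up => //; lia.
have down3 : down k 2 = down k 3 * s 2 by rewrite -down_recr //; lia.
have z3 q : z ^+ q * down k 3 = down k 3 * z ^+ q by apply: z_down => //; lia.
have slide q r : down k 3 * (z ^+ q * s 2 * z ^+ r) * r3 =
    z ^+ q * up 2 i.-1 * (down k 2 * z ^+ r).
  rewrite !mulrA -z3 -[_ * _ * s 2]mulrA -down3 -[_ * _ * r3]mulrA zr.
  by rewrite mulrA -[_ * down k 2 * r3]mulrA down_up ?mulrA //; lia.
have slide_span q r : coset_span k (down k 3 * (z ^+ q * s 2 * z ^+ r) * r3).
  rewrite slide; apply: coset_span_mull => //.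
  by apply: word_mul; [apply: word_zX | apply: word_up]; lia.
have -> : down k 2 * z ^+ p * up 2 i * z =
    down k 3 * (s 2 * z ^+ p * s 2 * z) * r3.
  by rewrite up2 down3 -!mulrA -[r3 * z]/(r3 * z ^+ 1) -zr expr1.
case: p pd => [//|p] pd; rewrite (reflectionX (quad _) zszs) ?mulrDr; last lia.
rewrite -scalerAr mulrDl -scalerAl mulrBr mulrBl; apply: spanD; last first.
  apply/spanZ/spanB; first by rewrite -{2}[z]expr1; apply: slide_span.
  by rewrite -{1}[z]expr1; apply: slide_span.
have -> : down k 3 * (z * s 2 * z ^+ p.+1 * s 2) * r3 =
    z ^+ 1 * (down k 2 * z ^+ p.+1 * up 2 i).
  by rewrite up2 down3 !mulrA z3 expr1.
by apply: coset_span_mull; [apply: word_zX | apply: span_downzup]; lia.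
Qed.

(** For j < i, s_j crosses s_2 ... s_i as s_{j+1}, then z^p unchanged and s_k ... s_2 as s_j, which
    lies in H_{k-1}. For j > i + 1 it comes out as s_{j-1}. *)
Let closed_downzup p i g : (1 <= p < d)%N -> (2 <= i <= k)%N -> generator k g ->
  coset_span k (down k 2 * z ^+ p * up 2 i * g).
Proof.
move=> pd ik [[_ ->]|[j jk ->]]; first exact: closed_downzup_z.
have through l : (3 <= l <= k)%N ->
    coset_span k (down k 2 * z ^+ p * s l * up 2 i).
  move=> lk; rewrite -[_ * _ * s l]mulrA z_comm ?mulrA ?down_s; try lia.
  rewrite -!mulrA; apply: coset_span_mull; first by apply: word_s; lia.
  by rewrite mulrA; apply: span_downzup; lia.
have [ji|ji] := ltnP i j.
  have [ji'|ji'] := ltnP i.+1 j.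
    rewrite -mulrA -up_comm => [|l lb]; last by apply: ss; lia.
    by rewrite mulrA; apply: through; lia.
  have -> : j = i.+1 by lia.
  by rewrite -mulrA -upS; [apply: span_downzup; lia | lia].
have [ji'|ji'] := ltnP j i.
  by rewrite -mulrA up_s ?mulrA; [apply: through | | ]; lia.
have -> : j = i by lia.
case: i ik {ji ji' through} => [//|i] ik.
rewrite upS ?[_ * (_ * s i.+1)]mulrA; last lia.
rewrite -[_ * s i.+1 * s i.+1]mulrA quad; last lia.
rewrite mulrDr mulr1 -scalerAr -[_ * s i.+1]mulrA -upS; last lia.
by apply: spanD; [apply: spanZ|]; apply: span_downzup; lia.
Qed.

Lemma coset_span_mulr_ge2 x g : coset_span k x -> generator k g ->
  coset_span k (x * g).
Proof.
move=> + kg; apply: (span_morph (f := fun x => x * g)) => [e y y'|y].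
  by rewrite mulrDl scalerAl.
case=> h kh [l + ->]; rewrite -mulrA => lk; apply: coset_span_mull => //.
move: lk; rewrite /coset_reps k1 !mem_cat => /or4P[].
- rewrite inE => /eqP ->.
  by rewrite -(@down_geq k k.+1) //; apply: closed_down => //; lia.
- case/mapP => i; rewrite mem_index_iota => ik ->.
  by apply: closed_down => //; lia.
- by case/mapP => p; rewrite mem_index_iota => pd ->; apply: closed_downz.
- case/allpairsP => -[p i] [/=]; rewrite !mem_index_iota => pd ik ->.
  by apply: closed_downzup => //; lia.
Qed.

End Closure.

Lemma coset_span_mulr k x g : (1 <= k <= n)%N ->
  coset_span k x -> generator k g -> coset_span k (x * g).
Proof.
have [k2|k2] := leqP 2 k; first by move=> kn; apply: coset_span_mulr_ge2; lia.
have [->|k_neq1] := eqVneq k 1%N; last by lia.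
move=> _ + gz; have {gz} -> : g = z by case: gz => [[]//|[j]]; lia.
apply: (span_morph (f := fun x => x * z)) => [e y y'|y].
  by rewrite mulrDl scalerAl.
case=> h kh [l + ->]; rewrite -mulrA => lk; apply: coset_span_mull => //.
case/mapP: lk => p _ ->; rewrite -exprSr; move: (z ^+ _) (zX_span p.+1).
apply: (span_morph (f := id)) => // _ [q qd ->].
apply: span_gen; exists 1; first exact: word1.
exists (z ^+ q); last by rewrite mul1r.
by apply/map_f; rewrite mem_index_iota.
Qed.

Lemma word_coset_span k x : (1 <= k <= n)%N -> word k x -> coset_span k x.
Proof.
move=> kn; elim=> [|y g _ IH kg]; last exact: coset_span_mulr.
apply: span_gen; exists 1; first exact: word1.
exists 1; last by rewrite mulr1.
rewrite /coset_reps; case: eqP => _; last by rewrite mem_head.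
by apply/mapP; exists 0%N; rewrite ?mem_index_iota.
Qed.

Definition products r : seq A :=
  foldr (fun i P => [seq x * y | x <- coset_reps i, y <- P]) [:: 1] r.

(** [products] folds from the right, whereas the induction on k appends the last factor. *)
Lemma mem_products_rcons r i x l : x \in products r -> l \in coset_reps i ->
  x * l \in products (rcons r i).
Proof.
rewrite /products; elim: r x => [|j r IHr] x.
  rewrite inE => /eqP -> li; rewrite mul1r -[l]mulr1.
  by apply/allpairsP; exists (l, 1); rewrite inE.
rewrite rcons_cons; case/allpairsP => -[y w] [/= yj wr ->] li; rewrite -mulrA.
by apply/allpairsP; exists (y, w * l); split => //=; apply: IHr.
Qed.

Lemma word_products k x : (k <= n)%N -> word k x ->
  span (fun y => y \in products (index_iota 1 k.+1)) x.
Proof.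
elim: k x => [|k IHk] x kn.
  have gen0 g : ~ generator 0 g by case=> [[]//|[j]]; lia.
  case=> [|y g _ /gen0 //]; apply: span_gen; exact: mem_head.
move=> /(word_coset_span _) => /(_ kn).
apply: (span_morph (f := id)) => // _ [h kh [l lk ->]].
move: h kh (IHk h (ltnW kn) kh) => h _.
apply: (span_morph (f := fun h => h * l)) => [e y y'|y yk].
  by rewrite mulrDl scalerAl.
apply: span_gen; suff -> : index_iota 1 k.+2 = rcons (index_iota 1 k.+1) k.+1.
  exact: mem_products_rcons.
by rewrite /index_iota !subSS !subn0 -cats1 -[X in iota 1 X]addn1 iotaD.
Qed.

End AbstractSpanning.

(** * Spanning and number of entries of Lambda *)

Section Spanning.
Context (d n : nat).
Local Notation H := (hecke d n).
Local Notation z := (hecke_z d n).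
Local Notation s j := (hecke_s d n j).
Local Notation a := (par_a d).
Implicit Types (i j k p : nat).

(** A relation, so that the image of a relator is built from the closure rules below along its
    syntax. *)
Definition image_of (x : freealg (R0 d) (hecke_gen n)) (y : H) : Prop :=
  quot_proj (@hecke_rel d n) x = y.

Let imM x1 x2 y1 y2 :
  image_of x1 y1 -> image_of x2 y2 -> image_of (x1 * x2) (y1 * y2).
Proof. by move=> <- <-; exact: rmorphM. Qed.
Let imB x1 x2 y1 y2 :
  image_of x1 y1 -> image_of x2 y2 -> image_of (x1 - x2) (y1 - y2).
Proof. by move=> <- <-; exact: rmorphB. Qed.
Let imD x1 x2 y1 y2 :
  image_of x1 y1 -> image_of x2 y2 -> image_of (x1 + x2) (y1 + y2).
Proof. by move=> <- <-; exact: raddfD. Qed.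
Let imZ c x1 y1 : image_of x1 y1 -> image_of (c *: x1) (c *: y1).
Proof. by move=> <-; exact: linearZ_LR. Qed.
Let imX k x1 y1 : image_of x1 y1 -> image_of (x1 ^+ k) (y1 ^+ k).
Proof. by move=> <-; exact: rmorphXn. Qed.
Let im1 : image_of 1 1.
Proof. exact: rmorph1. Qed.
Let imz : image_of (free_z d n) z. Proof. by []. Qed.
Let ims j : image_of (free_s d n j) (s j). Proof. by []. Qed.

Let im_rel x (y : H) : hecke_rel x -> image_of x y -> y = 0.
Proof.
move=> rx <-; rewrite -(rmorph0 (quot_proj _)); apply/quot_proj_eq.
by rewrite subr0 => I _; apply.
Qed.

Lemma hecke_refl : z * s 2 * z * s 2 = s 2 * z * s 2 * z.
Proof.
apply/eqP; rewrite -subr_eq0; apply/eqP; apply: (im_rel (HeckeZSZS d n)).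
exact: imB (imM (imM (imM imz (ims 2)) imz) (ims 2))
           (imM (imM (imM (ims 2) imz) (ims 2)) imz).
Qed.

Lemma hecke_zs j : (3 <= j <= n)%N -> z * s j = s j * z.
Proof.
move=> jn; apply/eqP; rewrite -subr_eq0; apply/eqP.
apply: (im_rel (HeckeZS d jn)).
exact: imB (imM imz (ims j)) (imM (ims j) imz).
Qed.

Lemma hecke_braid i : (2 <= i < n)%N ->
  s i * s i.+1 * s i = s i.+1 * s i * s i.+1.
Proof.
move=> iN; apply/eqP; rewrite -subr_eq0; apply/eqP.
have iN' : (2 <= i <= n.-1)%N by lia.
apply: (im_rel (HeckeBraid d iN')).
exact: imB (imM (imM (ims i) (ims i.+1)) (ims i))
           (imM (imM (ims i.+1) (ims i)) (ims i.+1)).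
Qed.

Lemma hecke_ss i j : (2 <= i <= n)%N -> (2 <= j <= n)%N ->
  (i.+1 < j)%N || (j.+1 < i)%N -> s i * s j = s j * s i.
Proof.
move=> iN jN ij; apply/eqP; rewrite -subr_eq0; apply/eqP.
apply: (im_rel (HeckeComm d iN jN ij)).
exact: imB (imM (ims i) (ims j)) (imM (ims j) (ims i)).
Qed.

Lemma hecke_zd : z ^+ d = \sum_(1 <= i < d) par_b d i *: z ^+ (d - i) + 1.
Proof.
apply/eqP; rewrite -subr_eq0 opprD addrA; apply/eqP.
apply: (im_rel (HeckeZ d n)); apply: (imB (imB (imX d imz) _) im1).
elim/big_rec2: _ => [|i y x _ IH]; first exact: rmorph0.
exact: imD (imZ _ (imX _ imz)) IH.
Qed.

Lemma hecke_quad j : (2 <= j <= n)%N -> s j * s j = a *: s j + 1.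
Proof.
move=> jn; apply/eqP; rewrite -subr_eq0 opprD addrA; apply/eqP.
apply: (im_rel (HeckeS d jn)).
exact: imB (imB (imX 2 (ims j)) (imZ a (ims j))) im1.
Qed.

Lemma free_span_words (x : freealg (R0 d) (hecke_gen n)) :
  span (fun y => exists w : seq (hecke_gen n),
    y = \prod_(g <- w) freegen (R0 d) g) x.
Proof.
have wordE (w : seq (hecke_gen n)) :
    \prod_(g <- w) freegen (R0 d) g = mkmalgU (FMonom w) 1.
  elim: w => [|g w IHw].
    by rewrite big_nil; congr mkmalgU; apply/eqP; rewrite fmP fm1.
  rewrite big_cons IHw malgM_def fgmulUU mulr1; congr mkmalgU.
  by apply/eqP; rewrite fmP fmM fmU.
rewrite (monalgE x); apply: span_sum => w _.
have -> : mkmalgU w (monalg.mcoeff w x) =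
    monalg.mcoeff w x *: (mkmalgU w 1 : freealg (R0 d) (hecke_gen n)).
  by rewrite -mul_malgC malgM_def fgmulUU mul1m mulr1.
by apply/spanZ/span_gen; exists (w : seq _); rewrite wordE fmK.
Qed.

Hypotheses (d_gt0 : (0 < d)%N) (n_gt0 : (0 < n)%N).

Lemma Lambda_span (x : H) : span (fun y => y \in Lambda d n) x.
Proof.
have [x' ->] := quot_proj_surj x.
apply: (span_morph (f := quot_proj _)) (free_span_words x') => [c y y'|y].
  exact: linearP.
case=> w ->.
rewrite rmorph_prod.
apply: (@word_products _ _ d n a (par_b d) z (hecke_s d n));
  [exact: hecke_refl | exact: hecke_zs | exact: hecke_braid | exact: hecke_ss
  | exact: hecke_zd | exact: hecke_quad | by [] | by [] | ].
elim/big_ind: _ => [|y1 y2 w1 w2|g _]; first exact: word1.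
  exact: (word_mul w1 w2).
apply: word_gen.
have [g0|g0] := posnP g.
  by left; split=> //; congr (quot_proj _ (freegen _ _)); apply: val_inj.
right; exists g.+1; first by have := ltn_ord g; lia.
congr (quot_proj _ (freegen _ _)); apply: val_inj.
by rewrite /= inordK.
Qed.

(** For i > 1 the count is 1 + (i - 1) + (d - 1) + (d - 1)(i - 1) = i d. *)
Lemma size_Lambda_ i : (0 < i)%N -> size (Lambda_ d n i) = (i * d)%N.
Proof.
rewrite /Lambda_; case: eqP => [->|i1] i0.
  by rewrite size_map size_iota subn0 mul1n.
rewrite !size_cat size_allpairs !size_map !size_iota /=; nia.
Qed.

Lemma size_Lambda : size (Lambda d n) = (d ^ n * n`!)%N.
Proof.
pose F r := foldr (fun i P => [seq x * y | x <- Lambda_ d n i, y <- P])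
  ([:: 1] : seq H) r.
have sF r : all (leq 1) r -> size (F r) = (\prod_(i <- r) (i * d))%N.
  elim: r => [|i r IHr] /=; first by rewrite big_nil.
  by case/andP => i0 /IHr E; rewrite big_cons size_allpairs size_Lambda_ // E.
rewrite -[Lambda d n]/(F _) sF; last first.
  by apply/allP => i; rewrite mem_index_iota => /andP[].
rewrite big_split /= mulnC fact_prod prod_nat_const_nat subSS subn0.
by rewrite mulnC.
Qed.

End Spanning.

(** Entries may repeat: each coefficient is put on the first occurrence, [index y e]. *)
Lemma span_coefs (R : comPzRingType) (V : lmodType R) (e : seq V) (x : V) :
  span (fun y => y \in e) x ->
  exists c : 'I_(size e) -> R, x = \sum_(i < size e) c i *: e`_i.
Proof.
elim=> [|c y x' ye _ [c' ->]].
  by exists (fun=> 0); rewrite big1 // => i _; rewrite scale0r.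
have ie : (index y e < size e)%N by rewrite index_mem.
exists (fun i => c *+ (i == Ordinal ie) + c' i).
under [RHS]eq_bigr do rewrite scalerDl.
rewrite big_split /=; congr (_ + _).
rewrite (bigD1 (Ordinal ie)) //= eqxx mulr1n nth_index // big1 ?addr0 //.
by move=> i /negbTE ->; rewrite scale0r.
Qed.

(** * Specializations of the parameters *)

(** Reduction modulo b compares the lowest digits, and division by b gives the induction. *)
Lemma digits_inj k b (f g : nat -> nat) :
    (forall i, (i < k)%N -> (f i < b)%N && (g i < b)%N) ->
    (\sum_(i < k) f i * b ^ i = \sum_(i < k) g i * b ^ i)%N ->
  forall i, (i < k)%N -> f i = g i.
Proof.
elim: k f g => [//|k IHk] f g fgb.
have split_sum (h : nat -> nat) : (\sum_(i < k.+1) h i * b ^ i =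
    (\sum_(i < k) h i.+1 * b ^ i) * b + h 0)%N.
  rewrite big_ord_recl expn0 muln1 addnC big_distrl /=; congr (_ + _)%N.
  by apply: eq_bigr => i _; rewrite expnSr mulnA.
have /andP[f0b g0b] := fgb 0%N isT.
have b_gt0 : (0 < b)%N by apply: leq_trans f0b.
rewrite !split_sum => E.
have E0 : f 0%N = g 0%N.
  by have /= := congr1 (modn^~ b) E; rewrite !modnMDl !modn_small.
move: E; rewrite E0 => /addIn/eqP; rewrite eqn_pmul2r // => /eqP E [//|i] ik.
by apply: (IHk (f \o succn) (g \o succn)) => // j jk; apply: fgb.
Qed.

(* Kronecker's substitution X_i |-> X^(b^i), for b larger than all exponents of
   p, separates the monomials of p. *)
Lemma mpoly_substX_neq0 (R : numDomainType) k (p : {mpoly int[k]}) : p != 0 ->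
  exists2 e : 'I_k -> nat, (forall i, (0 < e i)%N) &
    mpoly.mmap intr (fun i => 'X^(e i) : {poly R}) p != 0.
Proof.
move=> p0; pose b := (msize p).+1; pose e (i : 'I_k) := (b ^ i)%N.
exists e => [i|]; first by rewrite expn_gt0.
pose w (m : 'X_{1..k}) := (\sum_(i < k) m i * b ^ i)%N.
have wE m : mmap1 (fun i => 'X^(e i) : {poly R}) m = 'X^(w m).
  rewrite /mmap1 /w (big_morph _ (exprD 'X) (expr0 _)).
  by apply: eq_bigr => i _; rewrite -exprM mulnC.
have w_inj : {in msupp p &, injective w}.
  move=> m m' mp m'p /= E; apply/mnmP => i.
  (* Exponents are extended by 0 to all naturals, the form that [digits_inj] takes. *)
  pose f (m : 'X_{1..k}) j := if insub j is Some i then m i else 0%N.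
  have fE (m0 : 'X_{1..k}) (j : 'I_k) : f m0 j = m0 j by rewrite /f valK.
  rewrite -!fE; apply: (@digits_inj k b _ _ _ _ i (ltn_ord i)) => [j jk|].
    have -> : j = Ordinal jk by [].
    rewrite !fE !ltnS; apply/andP; split.
      apply: leq_trans (ltnW (msize_mdeg_lt mp)).
      by rewrite mdegE (bigD1 (Ordinal jk)) //= leq_addr.
    apply: leq_trans (ltnW (msize_mdeg_lt m'p)).
    by rewrite mdegE (bigD1 (Ordinal jk)) //= leq_addr.
  by under eq_bigr do rewrite fE; under [RHS]eq_bigr do rewrite fE.
have [m mp] : exists m, m \in msupp p.
  case E: (msupp p) => [|m r]; last by exists m; rewrite mem_head.
  by move/eqP: E; rewrite msupp_eq0 (negbTE p0).
apply/eqP => /(congr1 (fun q : {poly R} => q`_(w m))); apply/eqP.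
rewrite coef0 /mpoly.mmap coef_sum (bigD1_seq m) ?msupp_uniq //= big1_seq.
  rewrite addr0 wE -[X in X * _](rmorph_int polyC) coefCM coefXn eqxx mulr1.
  by rewrite intr_eq0 mcoeff_msupp in mp *.
move=> m' /andP[m'm m'p]; rewrite wE -[X in X * _](rmorph_int polyC) coefCM.
rewrite coefXn; case: eqP => [E|_]; last by rewrite mulr0.
by rewrite (w_inj _ _ mp m'p E) eqxx in m'm.
Qed.

Lemma rmorph_mmap_intr (R S : comNzRingType) (f : {rmorphism R -> S}) k
    (h : 'I_k -> R) (p : {mpoly int[k]}) :
  f (mpoly.mmap intr h p) = mpoly.mmap intr (f \o h) p.
Proof.
rewrite /mpoly.mmap raddf_sum; apply: eq_bigr => m _.
rewrite /= rmorphM rmorph_int rmorph_prod; congr (_ * _).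
by apply: eq_bigr => i _; rewrite rmorphXn.
Qed.

(** The naturals below [size P] are distinct in characteristic 0 and too many to be all roots. *)
Lemma poly_nonroot (R : numDomainType) (P : {poly R}) : P != 0 ->
  exists x, P.[x] != 0.
Proof.
move=> P0; pose r : seq R := [seq i%:R | i <- iota 0 (size P)].
have [Pr|/allPn[x _ Px]] := boolP (all (root P) r); last by exists x.
have r_uniq : uniq r.
  by rewrite map_inj_uniq ?iota_uniq // => i j /eqP; rewrite eqr_nat => /eqP.
by have := max_poly_roots P0 Pr r_uniq; rewrite size_map size_iota ltnn.
Qed.

Section Specialization.
Variable d : nat.
Hypothesis d_gt0 : (0 < d)%N.

Definition z_poly (R : nzRingType) (c : nat -> R) : {poly R} :=
  'X^d - \sum_(1 <= i < d) c i *: 'X^(d - i) - 1.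

Lemma map_z_poly (R S : nzRingType) (f : {rmorphism R -> S}) (c : nat -> R) :
  map_poly f (z_poly c) = z_poly (f \o c).
Proof.
rewrite /z_poly !rmorphB rmorph1 /= map_polyXn raddf_sum; congr (_ - _ - _).
by apply: eq_bigr => i _; rewrite /= map_polyZ map_polyXn.
Qed.

Lemma size_z_poly (R : nzRingType) (c : nat -> R) :
  (size (z_poly c) = d.+1) /\ z_poly c \is monic.
Proof.
rewrite /z_poly -addrA -opprD.
have sz : (size (\sum_(1 <= i < d) c i *: 'X^(d - i) + 1 : {poly R})%R <= d)%N.
  rewrite (leq_trans (size_polyD _ _)) // geq_max size_poly1 d_gt0 andbT.
  rewrite big_nat; apply: (leq_trans (size_sum _ _ _)); apply/bigmax_leqP_seq.
  move=> i _ ib; rewrite (leq_trans (size_scale_leq _ _)) // size_polyXn; lia.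
rewrite -size_polyN in sz.
split; first by rewrite size_polyDl size_polyXn.
by rewrite monicE lead_coefDl ?size_polyXn // lead_coefXn.
Qed.

(** Kronecker's [kappa] puts all parameters on one curve without killing p. At a point x of the
    curve where neither kappa p nor the resultant of F and F' vanishes, the b_i are frozen at their
    values, and a is then set free again as X. *)
Lemma exists_specialization (p : R0 d) : p != 0 ->
  exists phi : {rmorphism R0 d -> {poly algC}}, exists u : nat -> algC,
  [/\ phi (par_a d) = 'X,
      \prod_(j < d) ('X - (u j)%:P%:P) = z_poly (fun i => phi (par_b d i)),
      {in gtn d &, injective u} & phi p != 0].
Proof.
move=> /(mpoly_substX_neq0 algC)[e e0 p0].
pose kappa : {rmorphism R0 d -> {poly algC}} :=
  mpoly.mmap intr (fun i => 'X^(e i)).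
pose F := z_poly (fun i => kappa (par_b d i)).
pose at_ (x : algC) : {rmorphism {poly algC} -> algC} := horner_eval x.
have [szF monF] := size_z_poly (fun i => kappa (par_b d i)).
(* The leading coefficients 1 and d of F and F' survive evaluation, so the resultant commutes with
   it. *)
have dF0 : lead_coef F^`() = d%:R.
  have Fd : F^`()`_d.-1 = d%:R.
    rewrite coef_deriv prednK //; congr (_ *+ _).
    by rewrite -(monicP monF) lead_coefE szF.
  have sz : size F^`() = d.
    apply/eqP; rewrite eqn_leq -ltnS -szF lt_size_deriv -?size_poly_gt0 ?szF //.
    rewrite -[X in (X <= _)%N]prednK // ltnNge; apply/negP => sz.
    move: Fd; rewrite nth_default // => /esym/eqP.
    by rewrite -polyC_natr polyC_eq0 pnatr_eq0 gtn_eqF.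
  by rewrite lead_coefE sz.
have map_res x : (resultant F F^`()).[x] =
    resultant (map_poly (at_ x) F) (map_poly (at_ x) F)^`().
  rewrite deriv_map -map_resultant //.
    by rewrite (monicP monF) rmorph1 oner_eq0.
  by rewrite dF0 rmorph_nat pnatr_eq0 -lt0n.
have at_F x : map_poly (at_ x) F = z_poly (fun i => (kappa (par_b d i)).[x]).
  exact: map_z_poly.
have kb i : kappa (par_b d i) = 'X^(e (inord i)).
  by rewrite /kappa /= mpoly.mmapX mmap1U.
(* At X = 0 all b_i vanish, as the exponents [e i] are positive, and F becomes the separable
   polynomial X^d - 1. *)
have res0 : resultant F F^`() != 0.
  apply/eqP => /(congr1 (horner^~ 0))/eqP; rewrite map_res at_F horner0.
  have -> : z_poly (fun i => (kappa (par_b d i)).[0]) = 'X^d - 1 :> {poly algC}.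
    rewrite /z_poly big1 ?subr0 // => i _; rewrite kb hornerXn expr0n.
    by rewrite gtn_eqF ?e0 // scale0r.
  have := @separable_Xn_sub_1 algC d; rewrite unlock pnatr_eq0 -lt0n d_gt0.
  by move=> /(_ isT); rewrite resultant_eq0 /coprimep => /eqP ->.
have [x] := poly_nonroot (mulf_neq0 p0 res0).
rewrite hornerM mulf_eq0 negb_or => /andP[px].
rewrite map_res at_F; set c := fun i => _; rewrite resultant_eq0 => sep.
have [sz mon] := size_z_poly c.
have [r fr] := closed_field_poly_normal (z_poly c).
rewrite (monicP mon) scale1r in fr.
have r_uniq : uniq r.
  rewrite -separable_prod_XsubC -fr unlock /coprimep eqn_leq leqNgt sep.
  by rewrite lt0n size_poly_eq0 gcdp_eq0 -size_poly_eq0 sz.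
have sz_r : size r = d.
  have := congr1 (size \o polyseq) fr.
  by rewrite /= sz size_prod_XsubC => -[].
pose phi : {rmorphism R0 d -> {poly algC}} := mpoly.mmap intr
  (fun i => if i == ord0 then 'X else (x ^+ e i)%:P).
exists phi, (nth 0 r); split.
- by rewrite /phi /= mpoly.mmapX mmap1U eqxx.
- have phib i : (1 <= i < d)%N -> phi (par_b d i) = (c i)%:P.
    move=> ib; rewrite /phi /= mpoly.mmapX mmap1U /c kb hornerXn.
    by rewrite -val_eqE /= inordK; [case: i ib | lia].
  transitivity (map_poly polyC (z_poly c)).
    rewrite fr (big_nth 0) big_mkord sz_r rmorph_prod.
    by apply: eq_bigr => i _; rewrite /= map_polyXsubC.
  rewrite map_z_poly /z_poly; congr (_ - _ - _); rewrite !big_nat.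
  by apply: eq_bigr => i ib; rewrite /= phib.
- move=> i j; rewrite !inE => id jd /eqP.
  by rewrite nth_uniq ?sz_r // => /eqP.
(* Evaluating X at x^(e 0) turns phi p into the value of kappa p at x. *)
- apply/eqP => /(congr1 (horner^~ (x ^+ e ord0))); rewrite horner0 => H.
  case/eqP: px; rewrite -H -!horner_evalE /phi /kappa /= !rmorph_mmap_intr.
  apply: eq_bigr => m' _; congr (_ * _); apply: mmap1_eq => i /=.
  rewrite /horner_eval hornerXn; case: eqP => [->|_]; first by rewrite hornerX.
  by rewrite hornerC.
Qed.

End Specialization.

(** * Linear independence *)

Section Independence.
Context (d m : nat) (K : fieldType) (u : nat -> K).
Context (phi : {rmorphism R0 d -> {poly K}}).
Local Notation n := m.+1.
Local Notation L := (Lambda d n).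
Let uX j : {poly K} := (u j)%:P.

Hypotheses (d_gt0 : (0 < d)%N) (m_gt0 : (0 < m)%N).
Hypothesis u_inj : {in gtn d &, injective u}.
Hypothesis phi_a : phi (par_a d) = 'X.
Hypothesis phi_b : \prod_(j < d) ('X - (uX j)%:P) =
  'X^d - \sum_(1 <= i < d) phi (par_b d i) *: 'X^(d - i) - 1.

Let vect (x : hecke d n) : {ffun cword d n -> {poly K}^o} :=
  hecke_act 'X uX phi x (cyclic_vector d m {poly K}).
Let at0 : {rmorphism {poly K} -> K} := horner_eval 0.
Let vect0 x := map_vect at0 (vect x).

(** As Lambda spans H, this span contains [vect0 x] for all x in H. It thus contains the cyclic
    vector and is stable under T_k and Z at a = 0, so [cyclic_vector_generates] applies. *)
Let span_vect0 (f : {ffun cword d n -> K^o}) :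
  span (fun g => exists2 x, x \in L & g = vect0 x) f.
Proof.
have at0X : at0 'X = 0 by exact: hornerX.
have map_lin c g h : map_vect at0 (c *: g + h) =
    at0 c *: map_vect at0 g + map_vect at0 h :> {ffun cword d n -> K^o}.
  apply/ffunP => b; rewrite !ffunE rmorphD.
  by rewrite -![_ *: _]/(_ * _) rmorphM.
have span_all x : span (fun g => exists2 y, y \in L & g = vect0 y) (vect0 x).
  elim: (Lambda_span d_gt0 (isT : (0 < n)%N) x) => [|c y y' yL _ IH].
    have -> : vect0 0 = 0; last by left.
    rewrite /vect0 /vect (hecke_act0 m_gt0 phi_a phi_b).
    by apply/ffunP => b; rewrite !ffunE rmorph0.
  have -> : vect0 (c *: y + y') = at0 (phi c) *: vect0 y + vect0 y'.
    rewrite /vect0 -map_lin /vect (hecke_actD m_gt0 phi_a phi_b).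
    by rewrite (hecke_actZ m_gt0 phi_a phi_b).
  by apply: spanD => //; apply/spanZ/span_gen; exists y.
apply: (@cyclic_vector_generates _ _ _ (at0 \o uX)) => [i j|c g h|k g km|g|].
- by move=> id jd; rewrite /= /at0 /= /horner_eval !hornerC; exact: u_inj.
- by move=> Sg Sh; apply: spanD => //; apply: spanZ.
- move: g; apply: (span_morph (f := opTn 0 k)) => [*|_ [x _ ->]].
    exact: linearP.
  rewrite -at0X -map_opTn.
  have -> : opTn 'X k (vect x) = vect (hecke_s d n k.+2 * x).
    rewrite /vect (hecke_actM m_gt0 phi_a phi_b).
    by rewrite (hecke_act_s m_gt0 phi_a phi_b).
  exact: span_all.
- move: g; apply: (span_morph (f := opZ 0 (at0 \o uX))) => [*|_ [x _ ->]].
    exact: linearP.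
  rewrite -at0X -map_opZ.
  have -> : opZ 'X uX (vect x) = vect (hecke_z d n * x).
    rewrite /vect (hecke_actM m_gt0 phi_a phi_b).
    by rewrite (hecke_act_z m_gt0 phi_a phi_b).
  exact: span_all.
- have <- : vect0 1 = cyclic_vector d m K; last exact: span_all.
  rewrite /vect0 /vect (hecke_act1 m_gt0 phi_a phi_b).
  by apply/ffunP => b; rewrite !ffunE rmorph_nat.
Qed.

Lemma Lambda_specialized_free (c : 'I_(size L) -> R0 d) :
  \sum_(i < size L) c i *: L`_i = 0 -> forall i, phi (c i) = 0.
Proof.
have szL : size L = #|{: cword d n}| by rewrite size_Lambda ?card_cword.
(* Indexing by the number of words makes the matrix [P] square. *)
move: c; rewrite szL => c cL0 i.
pose P := \matrix_(k, b) vect L`_k (enum_val b) : 'M[{poly K}]_#|{: cword d n}|.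
have P0_unit : map_mx at0 P \in unitmx.
  (* By [span_vect0], every unit row vector lies in the row space of [P] at X = 0. *)
  rewrite -row_full_unit -sub1mx; apply/row_subP => b; rewrite row1.
  pose row_of (f : {ffun cword d n -> K^o}) : 'rV[K]_#|{: cword d n}| :=
    \row_b' f (enum_val b').
  have : span (fun w => (w <= map_mx at0 P)%MS)
      (row_of [ffun b' => (b' == enum_val b)%:R]).
    move: (span_vect0 [ffun b' => (b' == enum_val b)%:R]).
    apply: (span_morph (f := row_of)) => [e f g|_ [x xL ->]].
      by apply/rowP => b'; rewrite !mxE !ffunE.
    apply: span_gen; have kx : (index x L < #|{: cword d n}|)%N.
      by rewrite -szL index_mem.
    suff -> : row_of (vect0 x) = row (Ordinal kx) (map_mx at0 P).
      exact: row_sub.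
    by apply/rowP => b'; rewrite !mxE ffunE /= nth_index.
  have -> : row_of [ffun b' => (b' == enum_val b)%:R] = delta_mx 0 b.
    by apply/rowP => b'; rewrite !mxE !ffunE (inj_eq enum_val_inj) eqxx.
  elim=> [|e w w' wP _ IH]; first exact: sub0mx.
  by apply: addmx_sub => //; apply: scalemx_sub.
have detP : \det P != 0.
  apply/eqP => detP; move: P0_unit; rewrite unitmxE det_map_mx detP rmorph0.
  by rewrite unitr0.
pose v : 'rV_#|{: cword d n}| := \row_k phi (c k).
have vP : v *m P = 0.
  have vect_c : \sum_k vect (c k *: L`_k) = 0.
    rewrite /vect -(hecke_act_sum m_gt0 phi_a phi_b) cL0.
    exact: (hecke_act0 m_gt0 phi_a phi_b).
  apply/rowP => b; rewrite !mxE.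
  transitivity ((\sum_k vect (c k *: L`_k)) (enum_val b)).
    rewrite sum_ffunE; apply: eq_bigr => k _; rewrite !mxE.
    by rewrite [in RHS]/vect (hecke_actZ m_gt0 phi_a phi_b) [in RHS]ffunE.
  by rewrite vect_c ffunE.
(* The adjugate gives v det P = 0, and K[X] is an integral domain. *)
have : v *m (P *m \adj P) = 0 by rewrite mulmxA vP mul0mx.
rewrite mul_mx_adj mul_mx_scalar => /matrixP/(_ 0 i)/eqP.
by rewrite !mxE mulf_eq0 (negbTE detP) => /eqP.
Qed.

End Independence.

Theorem theorem6p1 (d n : nat) (hd : (1 < d)%N) (hn : (2 <= n)%N) :
  is_basis (Lambda d n).
Proof.
case: n hn => [//|m] m_gt0; split=> [v|c cL i].
  by apply: span_coefs; apply: Lambda_span => //; lia.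
(* A nonzero coefficient would survive some specialization, against [Lambda_specialized_free]. *)
apply: contrapT => /eqP/(exists_specialization (ltnW hd)).
case=> phi [u [pa pb u_inj]].
apply/negP; rewrite negbK; apply/eqP.
exact: (Lambda_specialized_free (ltnW hd) m_gt0 u_inj pa pb cL).
Qed.
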